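(* Let $T>0$, $\tau>0$ with $T=N\tau$ for some $N\in\mathbb{N}$, and set $K:=\lceil T/\tau\rceil$. Let $L>0$, $a_1,a_2\in\mathbb{R}\setminus\{0\}$, $d_1,d_2\in\mathbb{R}$, and let $\mu_1,\mu_2,\varphi,f$ be data as described in the context, with associated $G$, $\Phi$, $F$, $\Phi_n$, $F_n$. Assume that $$\omega_n^2:=\Big(\frac{n\pi a_1}{L}\Big)^2-d_1>0,\qquad \upsilon_n^2:=\Big(\frac{n\pi a_2}{L}\Big)^2-d_2>0$$ for all sufficiently large $n$. Assume that for some fixed $\alpha>0$, $$\lim_{n\to\infty}\Big(|\Phi_n(0)|+|\dot\Phi_n(0)|\Big)\,n^{K+3+\alpha}=0,$$ $$\lim_{n\to\infty}\max_{-\tau\le s\le 0}|\Phi_n(s)|\,n^{K+4+\alpha}=0,$$ $$\lim_{n\to\infty}\max_{0\le s\le T}|F_n(s)|\,n^{K+2+\alpha}=0.$$ Then the Fourier series representation $$v(t,x)=\sum_{n=1}^{\infty}\Bigg(C^{-\omega_n^2,-\upsilon_n^2}_{\tau}(t)\,\Phi_n(0)+S^{-\omega_n^2,-\upsilon_n^2}_{\tau}(t)\,\dot\Phi_n(0)-\upsilon_n^2\int_{-\tau}^{0}S^{-\omega_n^2,-\upsilon_n^2}_{\tau}(t-\tau-s)\,\Phi_n(s)\,ds+\int_{0}^{t}S^{-\omega_n^2,-\upsilon_n^2}_{\tau}(t-s)\,F_n(s)\,ds\Bigg)\sin\Big(\frac{n\pi}{L}x\Big)+G(t,x)$$ converges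 absolutely and uniformly on $[0,T]\times[0,L]$. Moreover, $$v,\ v_x,\ v_{xx},\ v_t,\ v_{tx}\in C([0,T]\times[0,L]),$$ and $v_{tt}$ exists and is continuous on each open step strip $((m-1)\tau,m\tau)\times[0,L]$ ($m=1,\dots,K$), with finite one-sided limits at $t=m\tau$ (from within the strips). All these derivatives can be obtained by termwise differentiation of the Fourier series on the corresponding domains, and the differentiated series converge absolutely and uniformly on those domains.
   Context: Setting. The data belong to the delayed wave problem $$\partial_{tt}v(t,x)=a_1^2\partial_{xx}v(t,x)+a_2^2\partial_{xx}v(t-\tau,x)+d_1v(t,x)+d_2v(t-\tau,x)+f(t,x),\quad (t,x)\in[0,T]\times[0,L],$$ with $v(t,0)=\mu_1(t)$, $v(t,L)=\mu_2(t)$ for $t\in[-\tau,T]$ and $v(t,x)=\varphi(t,x)$ for $(t,x)\in[-\tau,0]\times[0,L]$. Data: $\mu_1,\mu_2\in C^2([-\tau,T])$; $f$ is continuous on $[0,T]\times[0,L]$; $\varphi$ and $\partial_t\varphi$ are continuous on $[-\tau,0]\times[0,L]$; and $\varphi(t,0)=\mu_1(t)$, $\varphi(t,L)=\mu_2(t)$ for $t\in[-\tau,0]$. Define $$G(t,x):=\mu_1(t)+\frac{x}{L}\big(\mu_2(t)-\mu_1(t)\big)\ \text{ on }[-\tau,T]\times[0,L],\qquad \Phi:=\varphi-G\ \text{ on }[-\tau,0]\times[0,L],$$ $$F(t,x):=f(t,x)+d_1G(t,x)+d_2G(t-\tau,x)-\partial_{tt}G(t,x)\ \text{ on }[0,T]\times[0,L],$$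 $$\Phi_n(t):=\frac{2}{L}\int_0^L\Phi(t,s)\sin\Big(\frac{n\pi}{L}s\Big)ds,\quad t\in[-\tau,0],\qquad F_n(t):=\frac{2}{L}\int_0^LF(t,s)\sin\Big(\frac{n\pi}{L}s\Big)ds,\quad t\in[0,T],$$ for $n=1,2,\dots$; then $\Phi_n\in C^1([-\tau,0])$, and $\dot\Phi_n(0)$ is the one-sided derivative at $0$. Delayed perturbation functions. Write $(t)_+:=\max\{0,t\}$ and $0^0=1$. For $a,b\in\mathbb{R}$ and $t\ge 0$, $$C_{\tau}^{a,b}(t):=\sum_{k=0}^{\infty}\sum_{m=k}^{\infty}\binom{m}{k}a^{m-k}b^{k}\frac{(t-k\tau)_{+}^{2m}}{(2m)!},\qquad S_{\tau}^{a,b}(t):=\sum_{k=0}^{\infty}\sum_{m=k}^{\infty}\binom{m}{k}a^{m-k}b^{k}\frac{(t-k\tau)_{+}^{2m+1}}{(2m+1)!},$$ and both are extended by zero to negative arguments. In the series for $v$ they are used with $a=-\omega_n^2$, $b=-\upsilon_n^2$; only the real numbers $\omega_n^2,\upsilon_n^2$ enter (for the finitely many remaining $n$ they may be nonpositive). Time derivatives at $t=0$ and $t=T$ and space derivatives at $x=0,L$ are one-sided. Termwise differentiation refers to the sine series, with the corresponding derivative of $G$ added. *)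

(* Defs.v *)
(* Functions given on an interval or a rectangle are total functions; only
   their values on the domain are used. *)
From Stdlib Require Import Reals ZArith Zfloor.
From Coquelicot Require Import Coquelicot.
Open Scope R_scope.

Definition rect (a b c d : R) (t x : R) : Prop := a <= t <= b /\ c <= x <= d.

(* For [a <= x <= b], the derivative of [f] at [x] relative to [[a, b]]: it is
   one-sided at an end point, the usual derivative at an interior point, and
   does not depend on the values of [f] outside [[a, b]]. *)
Definition is_derive_in (a b : R) (f : R -> R) (x l : R) : Prop :=
  filterlim (fun y => (f y - f x) / (y - x))
    (within (fun y => a <= y <= b) (locally' x)) (locally l).

Definition ex_derive_in (a b : R) (f : R -> R) (x : R) : Prop :=
  exists l : R, is_derive_in a b f x l.

(* Meaningful only under [ex_derive_in a b f x], with [a < b] and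
   [a <= x <= b]; the derivative is then unique. *)
Definition Derive_in (a b : R) (f : R -> R) (x : R) : R :=
  iota (fun l : R => is_derive_in a b f x l).

Definition ex_partial_t (a b : R) (w : R -> R -> R) (t x : R) : Prop :=
  ex_derive_in a b (fun s => w s x) t.
Definition partial_t (a b : R) (w : R -> R -> R) (t x : R) : R :=
  Derive_in a b (fun s => w s x) t.
Definition ex_partial_x (a b : R) (w : R -> R -> R) (t x : R) : Prop :=
  ex_derive_in a b (fun y => w t y) x.
Definition partial_x (a b : R) (w : R -> R -> R) (t x : R) : R :=
  Derive_in a b (fun y => w t y) x.

Definition C2_on (a b : R) (g : R -> R) : Prop :=
  let I t := a <= t <= b in
  let g1 := Derive_in a b g in
  let g2 := Derive_in a b g1 in
  (forall t, I t -> ex_derive_in a b g t) /\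
  (forall t, I t -> ex_derive_in a b g1 t) /\
  continuous_on I g /\ continuous_on I g1 /\ continuous_on I g2.

Definition continuous2_on (D : R -> R -> Prop) (w : R -> R -> R) : Prop :=
  continuous_on (fun p : R * R => D (fst p) (snd p))
    (fun p : R * R => w (fst p) (snd p)).

(* Meaningful only when [|g|] attains its maximum on [[a, b]]. *)
Definition max_abs (a b : R) (g : R -> R) : R :=
  iota (fun M : R => (exists s, a <= s <= b /\ Rabs (g s) = M) /\
                     (forall s, a <= s <= b -> Rabs (g s) <= M)).

Definition pos_part (t : R) : R := Rmax 0 t.

(* The inner index is [j = m - k].  [Binomial.C] is qualified because
   Coquelicot's [C] is the type of complex numbers. *)
Definition delayC (tau a b t : R) : R :=
  if Rlt_dec t 0 then 0 else
  Series (fun k : nat => Series (fun j : nat =>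
    let m := (k + j)%nat in
    Binomial.C m k * a ^ (m - k) * b ^ k
      * (pos_part (t - INR k * tau) ^ (2 * m) / INR (fact (2 * m))))).

Definition delayS (tau a b t : R) : R :=
  if Rlt_dec t 0 then 0 else
  Series (fun k : nat => Series (fun j : nat =>
    let m := (k + j)%nat in
    Binomial.C m k * a ^ (m - k) * b ^ k
      * (pos_part (t - INR k * tau) ^ (2 * m + 1) / INR (fact (2 * m + 1))))).

Definition boundary_lift (L : R) (mu1 mu2 : R -> R) (t x : R) : R :=
  mu1 t + x / L * (mu2 t - mu1 t).

Definition sine_coeff (L : R) (w : R -> R -> R) (n : nat) (t : R) : R :=
  2 / L * RInt (fun s => w t s * sin (INR n * PI / L * s)) 0 L.

Definition converges_abs_unif (D : R -> R -> Prop) (u : nat -> R -> R -> R)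
    (s : R -> R -> R) : Prop :=
  (forall t x, D t x -> ex_series (fun n => Rabs (u n t x))) /\
  (forall eps : R, 0 < eps -> exists n0 : nat, forall n, (n0 <= n)%nat ->
     forall t x, D t x -> Rabs (sum_n (fun k => u k t x) n - s t x) < eps).

(* For [v = \sum_n u n + g] on [D] and a partial derivative [op] (existence
   predicate [ex]): [op v] exists on [D], and [\sum_n op (u n) + op g]
   converges to it on [D], absolutely and uniformly. *)
Definition termwise (ex : (R -> R -> R) -> R -> R -> Prop)
    (op : (R -> R -> R) -> R -> R -> R) (D : R -> R -> Prop)
    (u : nat -> R -> R -> R) (g v : R -> R -> R) : Prop :=
  (forall t x, D t x ->
     (forall n, ex (u n) t x) /\ ex g t x /\ ex v t x) /\
  converges_abs_unif D (fun n => op (u n)) (fun t x => op v t x - op g t x).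

(* Main.v *)
Require Import Defs.
From Stdlib Require Import Reals ZArith Zfloor Lra Lia Psatz.
From Coquelicot Require Import Coquelicot.
Open Scope R_scope.

(** The sine series converges, and may be differentiated termwise, as soon as its terms and their
    derivatives are dominated by a convergent series of numbers. For the mode of frequency
    [n * PI / L], with amplitude [y_n], this means that [n^2 |y_n|], [n |y_n'|] and [|y_n''|] must
    be bounded, uniformly on [[0, T]], by a multiple of the summable rate [n^(- 1 - alpha)]. All
    statements of the theorem on convergence, continuity and differentiation then follow from
    dominated convergence for series ([filterlim_Series], [is_derive_in_Series]), applied to the
    terms ([termwise_x], [termwise_t], [expands_continuous]).

    Regularity of the amplitudes. The delayed cosine [C] and the delayed sine [S] satisfy [S' = C]
    and [C' = a S + b S(. - tau)], by Pascal's rule for their coefficients ([dcosK_eq]). The given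
    amplitude contains [C], which has a kink in its derivative at [tau], and an integral over the
    history [Phi], which stops at time 0. The two irregularities cancel: integrating the equation of
    [C] turns the amplitude into [Phi 0 + Phi1 * S + S * H], where the last product is a convolution
    and the forcing [H] is continuous, the history being continued by its last value [Phi 0]
    ([ampl_eq]). Two derivatives of this expression are immediate, and they are continuous on the
    whole interval [[0, T]].

    Size of the kernels. The energy [C^2 + omega_n^2 S^2] is conserved without delay. On each
    delay step the delayed term, of size [upsilon_n^2 |S(. - tau)|], is governed by the energy of
    the preceding steps, and Gronwall's argument ([energy_step]) shows that the energy gains at
    most a factor of the order [n^2] per step. After [K] steps [S], [C] and [C'] are at most of the
    orders [n^(K-2)], [n^(K-1)] and [n^K] ([kernel_growth]). Against this growth, the assumed decay
    of the coefficients leaves the rate [n^(- 1 - alpha)] ([ampl_decay]), which is summable by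
    telescoping ([ex_series_Rpower]). *)

(** * Dominated convergence for series *)

Lemma filterlim_R {T} (F : (T -> Prop) -> Prop) {FF : Filter F} (f : T -> R) (l : R) :
  filterlim f F (locally l) <->
  forall eps : R, 0 < eps -> F (fun y => Rabs (f y - l) < eps).
Proof.
  split.
  - intros H eps Heps. apply (proj1 (filterlim_locally f l) H (mkposreal eps Heps)).
  - intros H. apply filterlim_locally. intros eps. apply (H eps (cond_pos eps)).
Qed.

Lemma dominated_ex_series (c M : nat -> R) (n0 : nat) :
  ex_series M -> (forall n, (n0 <= n)%nat -> Rabs (c n) <= M n) ->
  ex_series (fun n => Rabs (c n)).
Proof.
  intros HM Hc. apply (ex_series_incr_n _ n0).
  apply (ex_series_le (K := R_AbsRing) (V := R_CompleteNormedModule)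
           _ (fun k => M (n0 + k)%nat)).
  - intros n. unfold norm; simpl; unfold abs; simpl. rewrite Rabs_Rabsolu.
    apply Hc; lia.
  - apply (ex_series_incr_n M n0). exact HM.
Qed.

(** The index [N] depends on the majorant only. This one bound gives uniform convergence of a
    series of functions as well as limits taken under the sum. *)
Lemma dominated_tail (M : nat -> R) (n0 : nat) :
  ex_series M -> forall eps, 0 < eps ->
  exists N, forall n, (N <= n)%nat -> forall c : nat -> R,
    (forall k, (n0 <= k)%nat -> Rabs (c k) <= M k) ->
    Rabs (sum_n c n - Series c) < eps.
Proof.
  intros HM eps Heps.
  pose proof (Series_correct M HM) as Hs.
  destruct (proj1 (filterlim_R _ _ _) Hs eps Heps) as [N HN].
  exists (max n0 N). intros n Hn c Hc.
  assert (Hexc : ex_series (fun n => Rabs (c n))) by (apply dominated_ex_series with M n0; auto).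
  assert (Hexc' : ex_series c) by now apply ex_series_Rabs.
  assert (HN' : Rabs (sum_f_R0 M n - Series M) < eps).
  { rewrite <- sum_n_Reals. apply HN. lia. }
  clear HN. rename HN' into HN. rewrite sum_n_Reals.
  rewrite (Series_incr_n c (S n)) by (auto; lia).
  rewrite (Series_incr_n M (S n)) in HN by (auto; lia).
  simpl Init.Nat.pred in *.
  set (tM := Series (fun k => M (S n + k)%nat)) in *.
  set (tc := Series (fun k => c (S n + k)%nat)) in *.
  assert (Htc : Rabs tc <= tM).
  { apply Rle_trans with (Series (fun k => Rabs (c (S n + k)%nat))).
    - apply Series_Rabs. apply (ex_series_incr_n (fun k => Rabs (c k)) (S n)). exact Hexc.
    - apply Series_le.
      + intros k; split; [apply Rabs_pos | apply Hc; lia].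
      + apply (ex_series_incr_n M (S n)). exact HM. }
  replace (sum_f_R0 c n - (sum_f_R0 c n + tc)) with (- tc) by ring.
  rewrite Rabs_Ropp.
  match type of HN with Rabs ?e < _ => replace e with (- tM) in HN by ring end.
  rewrite Rabs_Ropp in HN. pose proof (Rle_abs tM). lra.
Qed.

Lemma filterlim_sum_n {T} (F : (T -> Prop) -> Prop) {FF : Filter F}
  (phi : nat -> T -> R) (l : nat -> R) (N : nat) :
  (forall n, filterlim (phi n) F (locally (l n))) ->
  filterlim (fun y => sum_n (fun n => phi n y) N) F (locally (sum_n l N)).
Proof.
  intros H. induction N as [|N IH].
  - rewrite sum_O. apply filterlim_ext with (phi 0%nat); auto.
    intros y. now rewrite sum_O.
  - rewrite sum_Sn.
    apply filterlim_ext with (fun y => plus (sum_n (fun n => phi n y) N) (phi (S N) y)).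
    + intros y. now rewrite sum_Sn.
    + eapply filterlim_comp_2; [exact IH | apply H | apply (filterlim_plus (V := R_NormedModule))].
Qed.

(** Dominated convergence for series along an arbitrary filter. For the neighbourhood filter of a
    rectangle it says that a dominated sum of continuous terms is continuous; for difference
    quotients it is termwise differentiation. *)
Lemma filterlim_Series {T} (F : (T -> Prop) -> Prop) {FF : Filter F}
  (phi : nat -> T -> R) (l M : nat -> R) (n0 : nat) :
  ex_series M ->
  (forall n, filterlim (phi n) F (locally (l n))) ->
  (forall n, (n0 <= n)%nat -> Rabs (l n) <= M n) ->
  F (fun y => forall n, (n0 <= n)%nat -> Rabs (phi n y) <= M n) ->
  filterlim (fun y => Series (fun n => phi n y)) F (locally (Series l)).
Proof.
  intros HM Hlim Hl Hphi. apply filterlim_R; [exact FF|]. intros eps Heps.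
  destruct (dominated_tail M n0 HM (eps / 3) ltac:(lra)) as [N HN].
  pose proof (proj1 (filterlim_R _ _ _)
    (filterlim_sum_n F phi l N Hlim) (eps / 3) ltac:(lra)) as Hfin.
  generalize (filter_and _ _ Hphi Hfin). apply filter_imp.
  intros y [Hy1 Hy2].
  pose proof (HN N (le_n _) l Hl) as H1.
  pose proof (HN N (le_n _) (fun n => phi n y) Hy1) as H2.
  apply Rabs_def2 in H1. apply Rabs_def2 in H2. apply Rabs_def2 in Hy2.
  apply Rabs_def1; lra.
Qed.

(** * Derivatives relative to an interval *)

Lemma locally'_within_proper (a b x : R) : a < b -> a <= x <= b ->
  ProperFilter' (within (fun y => a <= y <= b) (locally' x)).
Proof.
  intros Hab Hx. constructor.
  - intros [eps Heps]. pose proof (cond_pos eps) as He.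
    destruct (Rlt_dec x b) as [Hxb|Hxb].
    + set (d := Rmin (eps / 2) (b - x)).
      assert (0 < d) by (apply Rmin_glb_lt; lra).
      pose proof (Rmin_l (eps / 2) (b - x)). pose proof (Rmin_r (eps / 2) (b - x)).
      fold d in H0, H1.
      apply (Heps (x + d)).
      * unfold ball; simpl; unfold AbsRing_ball, abs, minus, plus, opp; simpl.
        replace (x + d + - x) with d by ring. rewrite Rabs_pos_eq; lra.
      * lra.
      * lra.
    + set (d := Rmin (eps / 2) (x - a)).
      assert (0 < d) by (apply Rmin_glb_lt; lra).
      pose proof (Rmin_l (eps / 2) (x - a)). pose proof (Rmin_r (eps / 2) (x - a)).
      fold d in H0, H1.
      apply (Heps (x - d)).
      * unfold ball; simpl; unfold AbsRing_ball, abs, minus, plus, opp; simpl.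
        replace (x - d + - x) with (- d) by ring. rewrite Rabs_Ropp, Rabs_pos_eq; lra.
      * lra.
      * lra.
  - apply within_filter. apply within_filter. apply locally_filter.
Qed.

#[local] Instance locally'_within_filter (a b x : R) :
  Filter (within (fun y => a <= y <= b) (locally' x)).
Proof. apply within_filter. apply within_filter. apply locally_filter. Qed.

#[local] Instance within_locally_filter {T : UniformSpace} (D : T -> Prop) (x : T) :
  Filter (within D (locally x)).
Proof. apply within_filter, locally_filter. Qed.

Lemma Derive_in_unique (a b : R) (f : R -> R) (x l : R) :
  a < b -> a <= x <= b -> is_derive_in a b f x l -> Derive_in a b f x = l.
Proof.
  intros Hab Hx H. unfold Derive_in, is_derive_in.
  apply (@iota_filterlim_locally R_AbsRing R_CompleteNormedModule).
  - now apply locally'_within_proper.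
  - exact H.
Qed.

Lemma Derive_in_correct (a b : R) (f : R -> R) (x : R) :
  a < b -> a <= x <= b -> ex_derive_in a b f x ->
  is_derive_in a b f x (Derive_in a b f x).
Proof. intros Hab Hx [l Hl]. now rewrite (Derive_in_unique a b f x l). Qed.

Lemma is_derive_in_ext (a b : R) (f g : R -> R) (x l : R) :
  a <= x <= b -> (forall y, a <= y <= b -> f y = g y) ->
  is_derive_in a b f x l -> is_derive_in a b g x l.
Proof.
  intros Hx Hfg. apply filterlim_within_ext.
  intros y Hy. now rewrite !Hfg.
Qed.

Lemma is_derive_in_le (a b a' b' : R) (f : R -> R) (x l : R) :
  a' <= a -> b <= b' -> is_derive_in a' b' f x l -> is_derive_in a b f x l.
Proof.
  intros Ha Hb H P HP. specialize (H P HP). unfold filtermap, within in *.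
  revert H. apply filter_imp. intros y Hy Hn. apply Hy. intros; lra.
Qed.

Lemma is_derive_locally' (f : R -> R) (x l : R) :
  is_derive f x l <->
  filterlim (fun y => (f y - f x) / (y - x)) (locally' x) (locally l).
Proof.
  rewrite is_derive_Reals. split.
  - intros H. apply filterlim_R; [typeclasses eauto|]. intros eps Heps.
    destruct (H eps Heps) as [d Hd]. exists d. refine (fun (y : R) Hy Hn => _).
    specialize (Hd (y - x)). replace (x + (y - x)) with y in Hd by ring.
    apply Hd; [|exact Hy]. intros E. apply Hn, Rminus_diag_uniq, E.
  - intros H eps Heps.
    destruct (proj1 (filterlim_R _ _ _) H eps Heps) as [d Hd]. exists d. intros h Hh Hn.
    specialize (Hd (x + h)). replace (x + h - x) with h in Hd by ring. apply Hd.
    + unfold ball; simpl; unfold AbsRing_ball, abs, minus, plus, opp; simpl.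
      now replace (x + h + - x) with h by ring.
    + lra.
Qed.

Lemma is_derive_is_derive_in (a b : R) (f : R -> R) (x l : R) :
  is_derive f x l -> is_derive_in a b f x l.
Proof.
  intros H. apply is_derive_locally' in H.
  intros P HP. specialize (H P HP). unfold filtermap, within in *.
  revert H. apply filter_imp. auto.
Qed.

(** Passing to the two-sided derivative at interior points makes the classical mean value theorem
    available. *)
Lemma is_derive_in_interior (a b : R) (f : R -> R) (x l : R) :
  a < x < b -> is_derive_in a b f x l -> is_derive f x l.
Proof.
  intros Hx H. apply is_derive_locally'. intros P HP. specialize (H P HP).
  unfold filtermap, within, locally' in *. unfold within in *.
  assert (Hn : locally x (fun y => a < y < b)).
  { apply (open_and _ _ (open_gt a) (open_lt b)). exact Hx. }
  generalize (filter_and _ _ H Hn). apply filter_imp. intros y [H1 H2] Hy.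
  apply H1. exact Hy. lra.
Qed.

Lemma is_derive_in_plus (a b : R) (f g : R -> R) (x l m : R) :
  is_derive_in a b f x l -> is_derive_in a b g x m ->
  is_derive_in a b (fun y => f y + g y) x (l + m).
Proof.
  intros Hf Hg. unfold is_derive_in.
  apply filterlim_ext with (fun y => plus ((f y - f x) / (y - x)) ((g y - g x) / (y - x))).
  - refine (fun y : R => _). change ((f y - f x) / (y - x) + (g y - g x) / (y - x)
      = (f y + g y - (f x + g x)) / (y - x) :> R).
    unfold Rdiv. ring.
  - eapply filterlim_comp_2; [exact Hf | exact Hg | apply (filterlim_plus (V := R_NormedModule))].
Qed.

Lemma is_derive_in_scal (a b : R) (f : R -> R) (c x l : R) :
  is_derive_in a b f x l -> is_derive_in a b (fun y => c * f y) x (c * l).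
Proof.
  intros Hf. unfold is_derive_in.
  apply filterlim_ext with (fun y => scal c ((f y - f x) / (y - x))).
  - refine (fun y : R => _).
    change (c * ((f y - f x) / (y - x)) = (c * f y - c * f x) / (y - x) :> R).
    unfold Rdiv. ring.
  - eapply filterlim_comp; [exact Hf | apply (filterlim_scal_r (V := R_NormedModule))].
Qed.

Lemma is_derive_in_scal_r (a b : R) (f : R -> R) (c x l : R) :
  is_derive_in a b f x l -> is_derive_in a b (fun y => f y * c) x (l * c).
Proof.
  intros Hf. rewrite Rmult_comm.
  unfold is_derive_in. apply filterlim_ext with (fun y => (c * f y - c * f x) / (y - x)).
  - refine (fun y : R => _).
    change ((c * f y - c * f x) / (y - x) = (f y * c - f x * c) / (y - x) :> R).
    unfold Rdiv. ring.
  - now apply is_derive_in_scal.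
Qed.

(** Composing with [clamp a b] extends a function continuous on [[a, b]] to a continuous function on
    the line, so that integration and compactness lemmas for total functions apply to it. *)
Definition clamp (a b x : R) : R := Rmax a (Rmin b x).

Lemma clamp_in (a b x : R) : a <= b -> a <= clamp a b x <= b.
Proof.
  intros H. unfold clamp. split; [apply Rmax_l|]. apply Rmax_lub; auto. apply Rmin_l.
Qed.

Lemma clamp_id (a b x : R) : a <= x <= b -> clamp a b x = x.
Proof. intros H. unfold clamp. rewrite Rmin_right, Rmax_right; lra. Qed.

Lemma clamp_lip (a b x y : R) : Rabs (clamp a b x - clamp a b y) <= Rabs (x - y).
Proof.
  unfold clamp, Rmax, Rmin.
  repeat (destruct (Rle_dec _ _)); unfold Rabs; repeat (destruct (Rcase_abs _)); lra.
Qed.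

Lemma clamp_continuous (a b x : R) : continuous (clamp a b) x.
Proof.
  apply filterlim_R; [typeclasses eauto|]. intros eps Heps. exists (mkposreal eps Heps).
  intros y Hy. eapply Rle_lt_trans; [apply clamp_lip | exact Hy].
Qed.

Lemma continuous_on_clamp (a b : R) (f : R -> R) (x : R) : a <= b ->
  continuous_on (fun y => a <= y <= b) f -> continuous (fun y => f (clamp a b y)) x.
Proof.
  intros Hab Hf. unfold continuous.
  apply filterlim_comp with (within (fun y => a <= y <= b) (locally (clamp a b x))).
  - intros P HP. unfold filtermap.
    pose proof (clamp_continuous a b x _ HP) as H. unfold filtermap in H.
    revert H. apply filter_imp. intros y Hy. apply Hy. now apply clamp_in.
  - apply Hf. now apply clamp_in.
Qed.

Lemma is_derive_in_continuous (a b : R) (f : R -> R) (x l : R) :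
  is_derive_in a b f x l ->
  filterlim f (within (fun y => a <= y <= b) (locally x)) (locally (f x)).
Proof.
  intros H. apply filterlim_R; [typeclasses eauto|]. intros eps Heps.
  pose proof (proj1 (filterlim_R _ _ _) H 1 Rlt_0_1) as H1.
  destruct H1 as [d Hd].
  assert (Hp : 0 < Rabs l + 1) by (pose proof (Rabs_pos l); lra).
  assert (He : 0 < Rmin d (eps / (Rabs l + 1))).
  { apply Rmin_glb_lt; [apply cond_pos|]. now apply Rdiv_lt_0_compat. }
  exists (mkposreal _ He). intros y Hy Hab. unfold ball in Hy; simpl in Hy.
  unfold AbsRing_ball, abs, minus, plus, opp in Hy; simpl in Hy.
  destruct (Req_dec y x) as [->|Hyx].
  { replace (f x - f x) with 0 by ring. rewrite Rabs_R0. lra. }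
  assert (Hyd : ball x d y).
  { unfold ball; simpl; unfold AbsRing_ball, abs, minus, plus, opp; simpl.
    eapply Rlt_le_trans; [exact Hy | apply Rmin_l]. }
  specialize (Hd y Hyd Hyx Hab). simpl in Hd.
  replace (f y - f x) with ((f y - f x) / (y - x) * (y - x)) by (field; lra).
  rewrite Rabs_mult.
  assert (Hq : Rabs ((f y - f x) / (y - x)) <= Rabs l + 1).
  { replace ((f y - f x) / (y - x)) with (l + ((f y - f x) / (y - x) - l)) by ring.
    eapply Rle_trans; [apply Rabs_triang|]. lra. }
  assert (Hyy : Rabs (y - x) < eps / (Rabs l + 1)).
  { eapply Rlt_le_trans; [exact Hy | apply Rmin_r]. }
  apply Rle_lt_trans with ((Rabs l + 1) * Rabs (y - x)).
  - apply Rmult_le_compat_r; [apply Rabs_pos | exact Hq].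
  - apply Rlt_le_trans with ((Rabs l + 1) * (eps / (Rabs l + 1))).
    + now apply Rmult_lt_compat_l.
    + right. field. lra.
Qed.

(** The mean value theorem is applied to [f] composed with the clamp, which is continuous on
    both sides of the end points; the derivative is needed at interior points only. *)
Lemma mean_value_bound (a b : R) (f df : R -> R) (B : R) :
  (forall x, a <= x <= b -> is_derive_in a b f x (df x)) ->
  (forall x, a <= x <= b -> Rabs (df x) <= B) ->
  forall x y, a <= x <= b -> a <= y <= b -> Rabs (f y - f x) <= B * Rabs (y - x).
Proof.
  intros Hd HB x y Hx Hy.
  assert (Hc : continuous_on (fun y => a <= y <= b) f).
  { intros z Hz. apply (is_derive_in_continuous a b f z (df z)). now apply Hd. }
  assert (Hab : a <= b) by lra.
  destruct (MVT_gen (fun z => f (clamp a b z)) x y df) as [c [Hc1 Hc2]].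
  - intros z Hz.
    assert (Hz' : a < z < b).
    { revert Hz. unfold Rmin, Rmax. destruct (Rle_dec x y); lra. }
    apply (is_derive_in_interior a b); auto.
    apply (is_derive_in_ext a b f); try lra.
    + intros w Hw. now rewrite clamp_id.
    + apply Hd; lra.
  - intros z Hz. apply continuity_pt_filterlim. now apply continuous_on_clamp.
  - rewrite !clamp_id in Hc2 by lra. rewrite Hc2, Rabs_mult.
    apply Rmult_le_compat_r; [apply Rabs_pos|]. apply HB.
    revert Hc1. unfold Rmin, Rmax. destruct (Rle_dec x y); lra.
Qed.

(** By the mean value bound, each difference quotient is dominated by the bound on the derivative
    of its term, so the sum of the quotients converges by [filterlim_Series]. *)
Lemma is_derive_in_Series (a b : R) (g dg : nat -> R -> R) (M : nat -> R) (n0 : nat) (x : R) :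
  a <= x <= b -> ex_series M ->
  (forall n y, a <= y <= b -> is_derive_in a b (g n) y (dg n y)) ->
  (forall n y, (n0 <= n)%nat -> a <= y <= b -> Rabs (dg n y) <= M n) ->
  (forall y, a <= y <= b -> ex_series (fun n => g n y)) ->
  is_derive_in a b (fun y => Series (fun n => g n y)) x (Series (fun n => dg n x)).
Proof.
  intros Hx HM Hd HB Hs.
  unfold is_derive_in.
  apply filterlim_within_ext with
    (f := fun y => Series (fun n => (g n y - g n x) / (y - x))).
  { intros y Hy. rewrite <- Series_minus by (now apply Hs).
    unfold Rdiv. rewrite Series_scal_r. reflexivity. }
  apply filterlim_Series with M n0; auto.
  - typeclasses eauto.
  - intros n. now apply (Hd n).
  - exists (mkposreal 1 Rlt_0_1). intros y _ Hyx Hy n Hn.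
    pose proof (mean_value_bound a b (g n) (dg n) (M n) (Hd n)
      (fun z Hz => HB n z Hn Hz) x y Hx Hy) as H.
    unfold Rdiv. rewrite Rabs_mult, Rabs_inv.
    assert (Hp : 0 < Rabs (y - x)) by (apply Rabs_pos_lt; lra).
    apply Rmult_le_reg_r with (Rabs (y - x)); auto.
    rewrite Rmult_assoc, Rinv_l by lra. lra.
Qed.

(** * The delayed perturbation functions *)

Lemma is_series_zero : is_series (fun _ : nat => 0) 0.
Proof.
  apply filterlim_ext with (fun _ => 0); [|apply filterlim_const].
  intros n. symmetry. rewrite sum_n_const. apply Rmult_0_r.
Qed.

Lemma Series_zero (c : nat -> R) : (forall n, c n = 0) -> Series c = 0.
Proof.
  intros H. rewrite (Series_ext c (fun _ => 0)) by auto.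
  apply is_series_unique, is_series_zero.
Qed.

Definition divpow (i : nat) (x : R) : R := x ^ i / INR (fact i).
Definition cterm (a : R) (k j : nat) (x : R) : R :=
  Binomial.C (k + j) k * a ^ j * divpow (2 * (k + j)) x.
Definition sterm (a : R) (k j : nat) (x : R) : R :=
  Binomial.C (k + j) k * a ^ j * divpow (2 * (k + j) + 1) x.
(** The derivative of [cterm], arranged by Pascal's rule [C(m,k) = C(m-1,k) + C(m-1,k-1)]:
    the first part reproduces [a] times the sine coefficient of order [k], shifted by one in
    [j], the second the sine coefficient of order [k-1]. *)
Definition dterm (a : R) (k j : nat) (x : R) : R :=
  match j with O => 0 | S j' => a * sterm a k j' x end
  + match k with O => 0 | S k' => sterm a k' j x end.

Lemma is_derive_divpow (i : nat) (x : R) :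
  is_derive (divpow (S i)) x (divpow i x).
Proof.
  assert (E : INR (fact (S i)) = INR (S i) * INR (fact i)) by (rewrite <- mult_INR; reflexivity).
  unfold divpow. rewrite E. auto_derive; [exact I|].
  pose proof (INR_fact_neq_0 i). assert (INR (S i) <> 0) by (apply not_0_INR; lia).
  simpl Init.Nat.pred. field. auto.
Qed.

Lemma divpow_0 (i : nat) : (0 < i)%nat -> divpow i 0 = 0.
Proof. intros Hi. unfold divpow. rewrite pow_i by auto. unfold Rdiv; ring. Qed.

Lemma C_n_n (n : nat) : Binomial.C n n = 1.
Proof.
  unfold Binomial.C. rewrite Nat.sub_diag. simpl. field. apply INR_fact_neq_0.
Qed.

Lemma C_n_0 (n : nat) : Binomial.C n 0 = 1.
Proof.
  unfold Binomial.C. rewrite Nat.sub_0_r. simpl. field. apply INR_fact_neq_0.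
Qed.

Lemma is_derive_sterm (a : R) (k j : nat) (x : R) :
  is_derive (sterm a k j) x (cterm a k j x).
Proof.
  unfold sterm, cterm. rewrite Nat.add_1_r.
  apply is_derive_scal. apply is_derive_divpow.
Qed.

Lemma is_derive_cterm (a : R) (k j : nat) (x : R) :
  is_derive (cterm a k j) x (dterm a k j x).
Proof.
  assert (Hm : forall m c,
    is_derive (fun y => c * divpow (2 * (S m)) y) x (c * divpow (2 * m + 1) x)).
  { intros m c. replace (2 * S m)%nat with (S (2 * m + 1)) by lia.
    apply is_derive_scal. apply is_derive_divpow. }
  unfold cterm, dterm, sterm. destruct k as [|k].
  - destruct j as [|j].
    + apply is_derive_ext with (fun _ => 1).
      * intros t. change (1 = Binomial.C 0 0 * 1 * (1 / 1)). rewrite C_n_0. field.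
      * rewrite Rplus_0_l. apply is_derive_Reals. apply derivable_pt_lim_const.
    + rewrite !C_n_0. specialize (Hm j (1 * a ^ S j)).
      replace (a * (1 * a ^ j * divpow (2 * (0 + j) + 1) x) + 0)
        with (1 * a ^ S j * divpow (2 * j + 1) x) by (simpl; ring).
      exact Hm.
  - destruct j as [|j].
    + rewrite !Nat.add_0_r, !C_n_n. specialize (Hm k (1 * a ^ 0)).
      rewrite Rplus_0_l. exact Hm.
    + specialize (Hm (S k + j)%nat (Binomial.C (S k + S j) (S k) * a ^ S j)).
      replace (S (S k + j))%nat with (S k + S j)%nat in Hm by lia.
      match type of Hm with is_derive _ _ ?d => match goal with |- is_derive _ _ ?d' =>
        replace d' with d; [exact Hm|] end end.
      replace (k + S j)%nat with (S k + j)%nat by lia.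
      replace (S k + S j)%nat with (S (S k + j)) by lia.
      rewrite <- (pascal (S k + j) k) by lia. simpl (a ^ S j). ring.
Qed.

Lemma fact_sqr_le (m : nat) : INR (fact m) * INR (fact m) <= INR (fact (2 * m)).
Proof.
  induction m as [|m IH]; [simpl; lra|].
  replace (2 * S m)%nat with (S (S (2 * m))) by lia.
  change (fact (S (S (2 * m)))) with (S (S (2 * m)) * (S (2 * m) * fact (2 * m)))%nat.
  change (fact (S m)) with (S m * fact m)%nat.
  rewrite !mult_INR, !S_INR, mult_INR. simpl (INR 2).
  pose proof (pos_INR m). pose proof (INR_fact_lt_0 m).
  set (p := INR (fact m)) in *. set (q := INR (fact (2 * m))) in *. set (r := INR m) in *.
  apply Rle_trans with ((r + 1) * (r + 1) * (p * p)); [right; ring|].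
  apply Rle_trans with ((r + 1) * (r + 1) * q).
  - apply Rmult_le_compat_l; nra.
  - assert (0 <= q) by nra. nra.
Qed.

Lemma C_le_fact (k j : nat) : 0 <= Binomial.C (k + j) k <= INR (fact (k + j)).
Proof.
  unfold Binomial.C.
  assert (H : forall i, 1 <= INR (fact i)).
  { intros i. change 1 with (INR 1). apply le_INR, lt_O_fact. }
  pose proof (H k). pose proof (H (k + j - k)%nat). pose proof (H (k + j)%nat).
  assert (1 <= INR (fact k) * INR (fact (k + j - k))) by nra.
  split.
  - apply Rdiv_le_0_compat; lra.
  - apply Rle_div_l; [lra|]. nra.
Qed.

(** Since [C(m,k) <= m!] and [m!^2 <= (2m)!], the coefficient [C(m,k)/(2m)!] is at most [1/m!]:
    the terms are dominated by a tail of an exponential series. The factor [1 + X] covers the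
    sine terms, which carry one more power of the argument. *)
Definition majorant (a X : R) (k j : nat) : R :=
  (1 + X) * (((1 + Rabs a) * X ^ 2) ^ (k + j) / INR (fact (k + j))).

Lemma ex_series_majorant (a X : R) (k : nat) : ex_series (majorant a X k).
Proof.
  unfold majorant. apply (ex_series_scal (V := R_NormedModule)).
  apply (ex_series_incr_n (fun m => ((1 + Rabs a) * X ^ 2) ^ m / INR (fact m)) k).
  exists (exp ((1 + Rabs a) * X ^ 2)).
  apply is_series_ext with (2 := is_exp_Reals ((1 + Rabs a) * X ^ 2)).
  intros n. unfold scal; simpl; unfold mult; simpl. rewrite pow_n_pow. reflexivity.
Qed.

Lemma term_majorant (a X x : R) (k j : nat) : Rabs x <= X ->
  Rabs (cterm a k j x) <= majorant a X k j /\ Rabs (sterm a k j x) <= majorant a X k j.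
Proof.
  intros Hx. pose proof (Rabs_pos x) as Hx0.
  assert (Hc : Rabs (cterm a k j x)
     <= ((1 + Rabs a) * X ^ 2) ^ (k + j) / INR (fact (k + j))).
  { unfold cterm, divpow. rewrite !Rabs_mult, Rabs_div by apply INR_fact_neq_0.
    rewrite <- !RPow_abs.
    destruct (C_le_fact k j) as [HC0 HC1]. rewrite (Rabs_pos_eq (Binomial.C _ _)) by auto.
    rewrite (Rabs_pos_eq (INR _)) by apply pos_INR.
    pose proof (fact_sqr_le (k + j)) as Hf. pose proof (INR_fact_lt_0 (k + j)) as Hf0.
    pose proof (INR_fact_lt_0 (2 * (k + j))) as Hf1.
    assert (Ha : Rabs a ^ j <= (1 + Rabs a) ^ (k + j)).
    { pose proof (Rabs_pos a). apply Rle_trans with ((1 + Rabs a) ^ j).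
      - apply pow_incr; lra.
      - apply Rle_pow; [lra | lia]. }
    assert (Hxx : Rabs x ^ (2 * (k + j)) <= (X ^ 2) ^ (k + j)).
    { rewrite <- pow_mult. apply pow_incr. lra. }
    assert (0 <= Rabs a ^ j) by apply pow_le, Rabs_pos.
    assert (0 <= Rabs x ^ (2 * (k + j))) by apply pow_le, Rabs_pos.
    assert (HCf : Binomial.C (k + j) k / INR (fact (2 * (k + j))) <= / INR (fact (k + j))).
    { apply Rle_div_l; [auto|]. apply Rmult_le_reg_l with (INR (fact (k + j))); auto.
      rewrite <- Rmult_assoc, Rinv_r by lra. nra. }
    rewrite Rpow_mult_distr.
    apply Rle_trans with (Rabs a ^ j * Rabs x ^ (2 * (k + j)) *
       (Binomial.C (k + j) k / INR (fact (2 * (k + j))))); [right; field; lra|].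
    unfold Rdiv at 2. apply Rmult_le_compat.
    - now apply Rmult_le_pos.
    - apply Rdiv_le_0_compat; auto.
    - now apply Rmult_le_compat.
    - exact HCf. }
  pose proof (Rabs_pos (cterm a k j x)) as Hc0.
  unfold majorant. split; [nra|].
  assert (Hs : sterm a k j x = cterm a k j x * (x / INR (2 * (k + j) + 1))).
  { unfold sterm, cterm, divpow. rewrite Nat.add_1_r.
    change (fact (S (2 * (k + j)))) with (S (2 * (k + j)) * fact (2 * (k + j)))%nat.
    rewrite mult_INR. pose proof (INR_fact_neq_0 (2 * (k + j))).
    assert (INR (S (2 * (k + j))) <> 0) by (apply not_0_INR; lia).
    rewrite <- tech_pow_Rmult. field. auto. }
  rewrite Hs, Rabs_mult.
  assert (Hd : Rabs (x / INR (2 * (k + j) + 1)) <= X).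
  { assert (1 <= INR (2 * (k + j) + 1)).
    { change 1 with (INR 1) at 1. apply le_INR. lia. }
    rewrite Rabs_div, (Rabs_pos_eq (INR _)) by lra.
    apply Rle_div_l; nra. }
  pose proof (Rabs_pos (x / INR (2 * (k + j) + 1))) as Hd0.
  apply Rle_trans with (((1 + Rabs a) * X ^ 2) ^ (k + j) / INR (fact (k + j)) * X); [|nra].
  now apply Rmult_le_compat.
Qed.

Definition scoef (a : R) (k : nat) (x : R) : R := Series (fun j => sterm a k j x).
Definition ccoef (a : R) (k : nat) (x : R) : R := Series (fun j => cterm a k j x).
(** The derivative of [ccoef a k]: the cosine coefficient of order [k] is driven by the sine
    coefficient of order [k-1], which is where the delay enters. *)
Definition dcoef (a : R) (k : nat) (x : R) : R :=
  a * scoef a k x + match k with O => 0 | S k' => scoef a k' x end.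

Lemma ex_series_sterm (a : R) (k : nat) (x : R) : ex_series (fun j => sterm a k j x).
Proof.
  apply ex_series_Rabs. apply dominated_ex_series with (majorant a (Rabs x) k) O.
  - apply ex_series_majorant.
  - intros n _. now apply term_majorant.
Qed.

Lemma ex_series_cterm (a : R) (k : nat) (x : R) : ex_series (fun j => cterm a k j x).
Proof.
  apply ex_series_Rabs. apply dominated_ex_series with (majorant a (Rabs x) k) O.
  - apply ex_series_majorant.
  - intros n _. now apply term_majorant.
Qed.

Lemma is_derive_scoef (a : R) (k : nat) (x : R) : is_derive (scoef a k) x (ccoef a k x).
Proof.
  set (X := Rabs x + 1). assert (Hx : - X < x < X).
  { unfold X. split; unfold Rabs; destruct (Rcase_abs x); lra. }
  apply (is_derive_in_interior (- X) X); auto.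
  apply (is_derive_in_Series _ _ _ _ (majorant a X k) O); try lra.
  - apply ex_series_majorant.
  - intros n y Hy. apply is_derive_is_derive_in, is_derive_sterm.
  - intros n y _ Hy. apply term_majorant. apply Rabs_le; lra.
  - intros y Hy. apply ex_series_sterm.
Qed.

Lemma continuous_scoef (a : R) (k : nat) (x : R) : continuous (scoef a k) x.
Proof.
  apply (ex_derive_continuous (V := R_NormedModule)). eexists. apply is_derive_scoef.
Qed.

Lemma is_series_dterm (a : R) (k : nat) (x : R) :
  is_series (fun j => dterm a k j x) (dcoef a k x).
Proof.
  unfold dterm, dcoef. apply (is_series_plus (V := R_NormedModule)).
  - apply is_series_decr_1.
    match goal with |- is_series _ ?l => replace l with (scal a (scoef a k x))
      by (change (a * scoef a k x = a * scoef a k x + - 0); ring) end.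
    apply (is_series_scal (V := R_NormedModule)). apply Series_correct, ex_series_sterm.
  - destruct k as [|k].
    + apply is_series_zero.
    + apply Series_correct, ex_series_sterm.
Qed.

Lemma is_derive_ccoef (a : R) (k : nat) (x : R) : is_derive (ccoef a k) x (dcoef a k x).
Proof.
  set (X := Rabs x + 1). assert (Hx : - X < x < X).
  { unfold X. split; unfold Rabs; destruct (Rcase_abs x); lra. }
  apply (is_derive_in_interior (- X) X); auto.
  rewrite <- (is_series_unique _ _ (is_series_dterm a k x)).
  set (M1 := fun j => match j with O => 0 | S j' => Rabs a * majorant a X k j' end).
  set (M2 := fun j => match k with O => 0 | S k' => majorant a X k' j end).
  apply (is_derive_in_Series _ _ _ _ (fun j => M1 j + M2 j) O); try lra.
  - apply (ex_series_plus (V := R_NormedModule)).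
    + apply (ex_series_incr_1 M1). apply (ex_series_scal (V := R_NormedModule)).
      apply ex_series_majorant.
    + unfold M2. destruct k; [|apply ex_series_majorant].
      exists 0. apply is_series_zero.
  - intros n y Hy. apply is_derive_is_derive_in, is_derive_cterm.
  - intros n y _ Hy. assert (Hy' : Rabs y <= X) by (apply Rabs_le; lra).
    unfold dterm. eapply Rle_trans; [apply Rabs_triang|].
    apply Rplus_le_compat; unfold M1, M2.
    + destruct n; [rewrite Rabs_R0; lra|]. rewrite Rabs_mult.
      apply Rmult_le_compat_l; [apply Rabs_pos|]. now apply term_majorant.
    + destruct k; [rewrite Rabs_R0; lra|]. now apply term_majorant.
  - intros y Hy. apply ex_series_cterm.
Qed.

Lemma scoef_0 (a : R) (k : nat) : scoef a k 0 = 0.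
Proof.
  apply Series_zero. intros j. unfold sterm. rewrite divpow_0 by lia. ring.
Qed.

Lemma ccoef_S_0 (a : R) (k : nat) : ccoef a (S k) 0 = 0.
Proof.
  apply Series_zero. intros j. unfold cterm. rewrite divpow_0 by lia. ring.
Qed.

Lemma ccoef_0_0 (a : R) : ccoef a 0 0 = 1.
Proof.
  unfold ccoef. rewrite Series_incr_1 by apply ex_series_cterm.
  rewrite Series_zero.
  - unfold cterm, divpow. simpl. rewrite C_n_0. field.
  - intros j. unfold cterm. rewrite divpow_0 by lia. ring.
Qed.

Lemma dcoef_0 (a : R) (k : nat) : dcoef a k 0 = 0.
Proof. unfold dcoef. destruct k; rewrite !scoef_0; ring. Qed.

(** The kink of the positive part at 0 is flattened because the derivative of [g] vanishes there. *)
Lemma is_derive_pos_part (g dg : R -> R) (t : R) :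
  (forall x, is_derive g x (dg x)) -> dg 0 = 0 ->
  is_derive (fun s => g (pos_part s)) t (dg (pos_part t)).
Proof.
  intros Hg Hg0. unfold pos_part. destruct (Rtotal_order t 0) as [Ht|[->|Ht]].
  - rewrite Rmax_left, Hg0 by lra.
    apply is_derive_ext_loc with (fun _ => g 0).
    + generalize (open_lt 0 t Ht). apply filter_imp. intros y Hy. now rewrite Rmax_left by lra.
    + apply is_derive_Reals, derivable_pt_lim_const.
  - rewrite Rmax_left by lra. pose proof (proj1 (is_derive_Reals _ _ _) (Hg 0)) as H0.
    apply is_derive_Reals. intros eps Heps. destruct (H0 eps Heps) as [d Hd]. exists d.
    intros h Hh Hhd. rewrite Rplus_0_l. rewrite (Rmax_left 0 0) by lra.
    destruct (Rle_dec 0 h) as [H|H].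
    + rewrite Rmax_right by lra. specialize (Hd h Hh Hhd). now rewrite Rplus_0_l in Hd.
    + rewrite Rmax_left by lra. rewrite Hg0.
      replace ((g 0 - g 0) / h - 0) with 0 by (field; lra). now rewrite Rabs_R0.
  - rewrite Rmax_right by lra. apply is_derive_ext_loc with g; [|apply Hg].
    generalize (open_gt 0 t Ht). apply filter_imp. intros y Hy. now rewrite Rmax_right by lra.
Qed.

(** The term of order 0 is evaluated at [t] itself and not at its positive part. The kernels built
    on it are thus differentiable across [t = 0], where the delayed functions are cut off. *)
Definition delay_arg (tau : R) (k : nat) (t : R) : R :=
  match k with O => t | S _ => pos_part (t - INR k * tau) end.
Definition dsum (g : nat -> R -> R) (tau b : R) (N : nat) (t : R) : R :=
  sum_n (fun k => b ^ k * g k (delay_arg tau k t)) N.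

Lemma is_derive_dsum (g dg : nat -> R -> R) (tau b : R) (N : nat) (t : R) :
  (forall k x, is_derive (g k) x (dg k x)) -> (forall k, dg (S k) 0 = 0) ->
  is_derive (dsum g tau b N) t (dsum dg tau b N t).
Proof.
  intros Hg Hg0. unfold dsum.
  apply (is_derive_sum_n (V := R_NormedModule) (fun k s => b ^ k * g k (delay_arg tau k s))).
  intros k _. apply is_derive_scal. destruct k as [|k]; [apply Hg|]. unfold delay_arg.
  replace (dg (S k) (pos_part (t - INR (S k) * tau)))
    with (scal 1 (dg (S k) (pos_part (t - INR (S k) * tau)))) by (apply Rmult_1_l).
  apply (is_derive_comp (fun s => g (S k) (pos_part s)) (fun s => s - INR (S k) * tau)).
  - apply (is_derive_pos_part (g (S k)) (dg (S k))); auto.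
  - auto_derive; auto.
Qed.

Lemma pos_part_continuous (t : R) : continuous pos_part t.
Proof.
  apply filterlim_R; [typeclasses eauto|]. intros eps Heps. exists (mkposreal eps Heps).
  intros y Hy. eapply Rle_lt_trans; [|exact Hy]. unfold pos_part, Rmax.
  change (abs (minus y t)) with (Rabs (y - t)).
  repeat destruct (Rle_dec _ _); unfold Rabs; repeat destruct (Rcase_abs _); lra.
Qed.

Lemma continuous_dsum (g : nat -> R -> R) (tau b : R) (N : nat) (t : R) :
  (forall k x, continuous (g k) x) -> continuous (dsum g tau b N) t.
Proof.
  intros Hg. unfold dsum, continuous.
  apply (filterlim_sum_n (locally t) (fun k s => b ^ k * g k (delay_arg tau k s))).
  intros k.
  apply (continuous_scal_r (V := R_NormedModule) (b ^ k) (fun s => g k (delay_arg tau k s))).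
  apply (continuous_comp (delay_arg tau k) (g k)); [|apply Hg].
  destruct k as [|k]; [apply continuous_id|].
  apply (continuous_comp (fun s => s - INR (S k) * tau) pos_part).
  - apply (ex_derive_continuous (V := R_NormedModule)). auto_derive; auto.
  - apply pos_part_continuous.
Qed.

Lemma Series_finite (c : nat -> R) (n : nat) :
  (forall k, (n < k)%nat -> c k = 0) -> Series c = sum_n c n.
Proof.
  intros Hc. apply is_series_unique.
  apply filterlim_ext_loc with (fun _ => sum_n c n); [|apply filterlim_const].
  exists n. intros m Hm. induction m as [|m IH].
  - now replace n with O by lia.
  - destruct (Nat.eq_dec n (S m)) as [->|Hne]; auto.
    rewrite sum_Sn, <- IH, (Hc (S m)) by lia. symmetry. apply Rplus_0_r.
Qed.

Section Kernel.
Variables (tau a b : R) (N : nat).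
Hypothesis tau_gt0 : 0 < tau.

(** On [0 <= t <= (N + 1) tau] only the orders [k <= N] contribute to the delayed functions, so
    the kernels are finite sums. *)
Definition sinK : R -> R := dsum (scoef a) tau b N.
Definition cosK : R -> R := dsum (ccoef a) tau b N.
Definition dcosK : R -> R := dsum (dcoef a) tau b N.

Lemma is_derive_sinK (t : R) : is_derive sinK t (cosK t).
Proof. apply is_derive_dsum; intros; [apply is_derive_scoef | apply ccoef_S_0]. Qed.

Lemma is_derive_cosK (t : R) : is_derive cosK t (dcosK t).
Proof. apply is_derive_dsum; intros; [apply is_derive_ccoef | apply dcoef_0]. Qed.

Lemma continuous_dcosK (t : R) : continuous dcosK t.
Proof.
  apply continuous_dsum. intros k x. unfold dcoef.
  apply (continuous_plus (V := R_NormedModule)).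
  - apply (continuous_scal_r (V := R_NormedModule)), continuous_scoef.
  - destruct k; [apply continuous_const | apply continuous_scoef].
Qed.

Lemma continuous_sinK (t : R) : continuous sinK t.
Proof.
  apply (ex_derive_continuous (V := R_NormedModule)). eexists. apply is_derive_sinK.
Qed.

Lemma continuous_cosK (t : R) : continuous cosK t.
Proof.
  apply (ex_derive_continuous (V := R_NormedModule)). eexists. apply is_derive_cosK.
Qed.

Lemma delay_arg_nonpos (k : nat) (t : R) : t <= 0 -> delay_arg tau (S k) t = 0.
Proof.
  intros Ht. unfold delay_arg, pos_part. rewrite Rmax_left; auto.
  pose proof (pos_INR (S k)). nra.
Qed.

Lemma sinK_0 : sinK 0 = 0.
Proof.
  assert (H : forall k, b ^ k * scoef a k (delay_arg tau k 0) = 0).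
  { intros [|k]; [simpl; rewrite scoef_0; ring|].
    rewrite delay_arg_nonpos, scoef_0 by lra. ring. }
  unfold sinK, dsum. rewrite (sum_n_ext _ _ N H), sum_n_const. apply Rmult_0_r.
Qed.

Lemma cosK_0 : cosK 0 = 1.
Proof.
  unfold cosK, dsum. induction N as [|n IH].
  - rewrite sum_O. simpl. rewrite ccoef_0_0. ring.
  - rewrite sum_Sn, IH, delay_arg_nonpos, ccoef_S_0 by lra.
    unfold plus; simpl. ring.
Qed.

(** The kernels solve [S'' = a S + b S(. - tau)], where the delayed [S] is read as 0 at
    negative arguments.
    The index shift [k -> k - 1] leaves the term of order [N], which vanishes in the range
    of [t]. *)
Lemma dcosK_eq (t : R) : t <= (INR N + 1) * tau ->
  dcosK t = a * sinK t + b * sinK (pos_part (t - tau)).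
Proof.
  intros Ht.
  assert (Harg : forall k, delay_arg tau k (pos_part (t - tau)) = pos_part (t - INR (S k) * tau)).
  { intros k. rewrite S_INR. unfold delay_arg, pos_part. destruct k as [|k].
    - simpl. f_equal. ring.
    - pose proof (pos_INR (S k)). assert (0 <= INR (S k) * tau) by nra.
      unfold Rmax; repeat destruct (Rle_dec _ _); nra. }
  assert (Hgen : forall n, dsum (dcoef a) tau b n t
     = a * dsum (scoef a) tau b n t + b * dsum (scoef a) tau b n (pos_part (t - tau))
       - b ^ S n * scoef a n (pos_part (t - INR (S n) * tau))).
  { intros n. unfold dsum. induction n as [|n IH].
    - rewrite !sum_O. rewrite Harg. unfold dcoef. simpl delay_arg. simpl pow. ring.
    - rewrite !sum_Sn, IH, Harg. unfold dcoef.
      change (delay_arg tau (S n) t) with (pos_part (t - INR (S n) * tau)).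
      simpl pow. unfold plus; simpl. ring. }
  unfold dcosK. rewrite Hgen.
  replace (pos_part (t - INR (S N) * tau)) with 0.
  - rewrite scoef_0. unfold sinK. ring.
  - symmetry. unfold pos_part. apply Rmax_left. rewrite S_INR. lra.
Qed.

Lemma delay_arg_pos (k : nat) (t : R) : 0 <= t ->
  pos_part (t - INR k * tau) = delay_arg tau k t.
Proof.
  intros Ht. destruct k; [|reflexivity]. simpl. unfold pos_part. rewrite Rmax_right; lra.
Qed.

Lemma delay_arg_late (k : nat) (t : R) : t <= (INR N + 1) * tau -> (N < k)%nat ->
  pos_part (t - INR k * tau) = 0.
Proof.
  intros Ht Hk. unfold pos_part. apply Rmax_left.
  assert (INR (S N) <= INR k) by (apply le_INR; lia). rewrite S_INR in H. nra.
Qed.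

Lemma delayS_sinK (t : R) : t <= (INR N + 1) * tau ->
  delayS tau a b t = sinK (pos_part t).
Proof.
  intros Ht. unfold delayS. destruct (Rlt_dec t 0) as [Hneg|Hpos].
  - unfold pos_part. now rewrite Rmax_left, sinK_0 by lra.
  - replace (pos_part t) with t by (unfold pos_part; rewrite Rmax_right; lra).
    assert (Hinner : forall k, Series (fun j => Binomial.C (k + j) k * a ^ (k + j - k) * b ^ k
      * (pos_part (t - INR k * tau) ^ (2 * (k + j) + 1) / INR (fact (2 * (k + j) + 1))))
      = b ^ k * scoef a k (pos_part (t - INR k * tau))).
    { intros k. unfold scoef. rewrite <- Series_scal_l. apply Series_ext. intros j.
      unfold sterm, divpow. replace (k + j - k)%nat with j by lia. ring. }
    rewrite (Series_ext _ _ Hinner). rewrite (Series_finite _ N).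
    + apply sum_n_ext. intros k. now rewrite delay_arg_pos by lra.
    + intros k Hk. rewrite delay_arg_late, scoef_0 by auto. ring.
Qed.

Lemma delayC_cosK (t : R) : 0 <= t <= (INR N + 1) * tau ->
  delayC tau a b t = cosK t.
Proof.
  intros Ht. unfold delayC. destruct (Rlt_dec t 0) as [Hneg|Hpos]; [lra|].
  assert (Hinner : forall k, Series (fun j => Binomial.C (k + j) k * a ^ (k + j - k) * b ^ k
    * (pos_part (t - INR k * tau) ^ (2 * (k + j)) / INR (fact (2 * (k + j)))))
    = b ^ k * ccoef a k (pos_part (t - INR k * tau))).
  { intros k. unfold ccoef. rewrite <- Series_scal_l. apply Series_ext. intros j.
    unfold cterm, divpow. replace (k + j - k)%nat with j by lia. ring. }
  rewrite (Series_ext _ _ Hinner). rewrite (Series_finite _ N).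
  - apply sum_n_ext. intros k. now rewrite delay_arg_pos by lra.
  - intros k Hk. rewrite delay_arg_late by (auto; lra). destruct k; [lia|].
    rewrite ccoef_S_0. ring.
Qed.

End Kernel.

(** * Integrals with a parameter and convolutions *)

Lemma continuous_2d_slice (g : R -> R -> R) (t s : R) :
  continuity_2d_pt g t s -> continuous (g t) s.
Proof.
  intros Hg. apply filterlim_R; [typeclasses eauto|]. intros eps Heps.
  apply (locally_2d_1d_const_x (fun u v => Rabs (g u v - g t s) < eps) t s).
  apply (Hg (mkposreal eps Heps)).
Qed.

Lemma continuity_2d_swap (g : R -> R -> R) (t s : R) :
  continuity_2d_pt g t s -> continuity_2d_pt (fun v u => g u v) s t.
Proof.
  intros Hg eps. destruct (Hg eps) as [d Hd]. exists d. intros u v Hu Hv. now apply Hd.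
Qed.

Lemma ex_RInt_cont (f : R -> R) (a b : R) : (forall x, continuous f x) -> ex_RInt f a b.
Proof. intros Hf. apply (ex_RInt_continuous (V := R_CompleteNormedModule)). auto. Qed.

Lemma RInt_lin (f g : R -> R) (c d a b : R) :
  (forall x, continuous f x) -> (forall x, continuous g x) ->
  RInt (fun s => c * f s + d * g s) a b = c * RInt f a b + d * RInt g a b.
Proof.
  intros Hf Hg.
  pose proof (ex_RInt_cont f a b Hf) as Ef. pose proof (ex_RInt_cont g a b Hg) as Eg.
  assert (E1 : RInt (fun s => c * f s) a b = c * RInt f a b)
    by exact (RInt_scal (V := R_CompleteNormedModule) f a b c Ef).
  assert (E2 : RInt (fun s => d * g s) a b = d * RInt g a b)
    by exact (RInt_scal (V := R_CompleteNormedModule) g a b d Eg).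
  rewrite <- E1, <- E2.
  apply (RInt_plus (V := R_CompleteNormedModule) (fun s => c * f s) (fun s => d * g s));
    now apply (ex_RInt_scal (V := R_NormedModule)).
Qed.

Lemma RInt_split (f : R -> R) (a b c : R) : (forall x, continuous f x) ->
  RInt f a c = RInt f a b + RInt f b c.
Proof.
  intros Hf. symmetry.
  apply (RInt_Chasles (V := R_CompleteNormedModule)); now apply ex_RInt_cont.
Qed.

Lemma RInt_reflect (f : R -> R) (c x y : R) : (forall z, continuous f z) ->
  RInt (fun s => f (c - s)) x y = RInt f (c - y) (c - x).
Proof.
  intros Hf.
  pose proof (RInt_comp_lin (V := R_CompleteNormedModule) f (-1) c x y) as E.
  replace (-1 * x + c) with (c - x) in E by ring.
  replace (-1 * y + c) with (c - y) in E by ring.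
  specialize (E (ex_RInt_cont f _ _ Hf)).
  assert (E1 : RInt (fun s => -1 * f (-1 * s + c)) x y = RInt f (c - x) (c - y)) by exact E.
  assert (E2 : RInt (fun s => -1 * f (c - s)) x y = -1 * RInt (fun s => f (c - s)) x y).
  { apply (RInt_scal (V := R_CompleteNormedModule)).
    apply ex_RInt_cont. intros z.
    apply (continuous_comp (fun s => c - s) f); [|apply Hf].
    apply (ex_derive_continuous (V := R_NormedModule)). auto_derive; auto. }
  assert (E3 : - RInt f (c - x) (c - y) = RInt f (c - y) (c - x)).
  { apply (opp_RInt_swap (V := R_CompleteNormedModule)). now apply ex_RInt_cont. }
  rewrite (RInt_ext _ (fun s => -1 * f (c - s))) in E1.
  - lra.
  - intros s _. now replace (-1 * s + c) with (c - s) by ring.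
Qed.

Lemma continuous_RInt_param (g : R -> R -> R) (a b t : R) : a <= b ->
  (forall u v, continuity_2d_pt g u v) ->
  continuous (fun u => RInt (g u) a b) t.
Proof.
  intros Hab Hg. apply filterlim_R; [typeclasses eauto|]. intros eps Heps.
  assert (He : 0 < eps / (b - a + 1)) by (apply Rdiv_lt_0_compat; lra).
  destruct (uniform_continuity_2d_1d (fun v u => g u v) a b t
    (fun v _ => continuity_2d_swap g t v (Hg t v)) (mkposreal _ He)) as [d Hd].
  exists d. refine (fun (u : R) Hu => _). change (Rabs (u - t) < d) in Hu.
  assert (Hex : forall w, ex_RInt (g w) a b).
  { intros w. apply ex_RInt_cont. intros x. apply continuous_2d_slice. apply Hg. }
  replace (RInt (g u) a b - RInt (g t) a b) with (RInt (fun x => minus (g u x) (g t x)) a b)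
    by (apply (RInt_minus (V := R_CompleteNormedModule)); apply Hex).
  apply Rle_lt_trans with ((b - a) * (eps / (b - a + 1))).
  - apply abs_RInt_le_const; auto.
    + now apply (ex_RInt_minus (V := R_NormedModule)).
    + intros x Hx. left. apply Rabs_def2 in Hu. pose proof (cond_pos d).
      apply (Hd x t x u); try lra. rewrite Rminus_diag, Rabs_R0; lra.
  - apply Rlt_le_trans with ((b - a + 1) * (eps / (b - a + 1))); [|right; field; lra].
    apply Rmult_lt_compat_r; lra.
Qed.

Definition conv (k h : R -> R) (t : R) : R := RInt (fun s => k (t - s) * h s) 0 t.

Lemma continuous_conv_integrand (k h : R -> R) (t s : R) :
  (forall x, continuous k x) -> (forall x, continuous h x) ->
  continuous (fun s => k (t - s) * h s) s.
Proof.
  intros Hk Hh. apply (continuous_mult (K := R_AbsRing)); [|apply Hh].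
  apply (continuous_comp (fun s => t - s) k); [|apply Hk].
  apply (ex_derive_continuous (V := R_NormedModule)). auto_derive; auto.
Qed.

Lemma continuity_2d_conv_integrand (k h : R -> R) (t s : R) :
  (forall x, continuous k x) -> (forall x, continuous h x) ->
  continuity_2d_pt (fun u v => k (u - v) * h v) t s.
Proof.
  intros Hk Hh. apply continuity_2d_pt_mult.
  - apply continuity_1d_2d_pt_comp.
    + apply continuity_pt_filterlim, Hk.
    + apply continuity_2d_pt_minus; [apply continuity_2d_pt_id1 | apply continuity_2d_pt_id2].
  - apply (continuity_1d_2d_pt_comp h (fun _ v => v)).
    + apply continuity_pt_filterlim, Hh.
    + apply continuity_2d_pt_id2.
Qed.

(** The substitution [s = t r] moves the variable upper bound into the integrand. *)
Lemma continuous_conv (k h : R -> R) (t : R) :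
  (forall x, continuous k x) -> (forall x, continuous h x) -> continuous (conv k h) t.
Proof.
  intros Hk Hh.
  apply continuous_ext with (fun u => RInt (fun r => u * (k (u - u * r) * h (u * r))) 0 1).
  - intros u. unfold conv.
    pose proof (RInt_comp_lin (V := R_CompleteNormedModule)
      (fun s => k (u - s) * h s) u 0 0 1) as E.
    rewrite Rmult_0_r, Rmult_1_r, !Rplus_0_r in E. rewrite <- E.
    + apply RInt_ext. intros x _. now rewrite !Rplus_0_r.
    + apply ex_RInt_cont. intros x. now apply continuous_conv_integrand.
  - apply (continuous_RInt_param (fun u r => u * (k (u - u * r) * h (u * r)))); [lra|].
    intros u v. assert (Huv : continuity_2d_pt (fun u v => u * v) u v).
    { apply continuity_2d_pt_mult; [apply continuity_2d_pt_id1 | apply continuity_2d_pt_id2]. }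
    apply continuity_2d_pt_mult; [apply continuity_2d_pt_id1|].
    apply continuity_2d_pt_mult.
    + apply continuity_1d_2d_pt_comp; [apply continuity_pt_filterlim, Hk|].
      apply continuity_2d_pt_minus; [apply continuity_2d_pt_id1 | exact Huv].
    + apply continuity_1d_2d_pt_comp; [apply continuity_pt_filterlim, Hh | exact Huv].
Qed.

Lemma is_derive_conv (k dk h : R -> R) (t : R) :
  (forall x, is_derive k x (dk x)) -> (forall x, continuous dk x) ->
  (forall x, continuous h x) ->
  is_derive (conv k h) t (k 0 * h t + conv dk h t).
Proof.
  intros Hk Hdk Hh.
  assert (Hkc : forall x, continuous k x).
  { intros x. apply (ex_derive_continuous (V := R_NormedModule)). eexists. apply Hk. }
  assert (Hd : forall u v, is_derive (fun z => k (z - v) * h v) u (dk (u - v) * h v)).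
  { intros u v. evar (l : R). replace (dk (u - v) * h v) with l.
    - apply (is_derive_ext (fun z => scal (h v) (k (z - v)))).
      + intros z. apply Rmult_comm.
      + apply is_derive_scal. apply (is_derive_comp k (fun z => z - v)); [apply Hk|].
        auto_derive; auto.
    - unfold l, scal; simpl; unfold mult; simpl. ring. }
  assert (HD : forall u v, continuity_2d_pt
     (fun u v => Derive (fun z => k (z - v) * h v) u) u v).
  { intros u v. apply continuity_2d_pt_ext with (fun u v => dk (u - v) * h v).
    - intros x y. symmetry. now apply is_derive_unique.
    - now apply continuity_2d_conv_integrand. }
  assert (Hex : forall y a b, ex_RInt (fun s => k (y - s) * h s) a b).
  { intros. apply ex_RInt_cont. intros x. now apply continuous_conv_integrand. }
  pose proof (is_derive_RInt_param_bound_comp_aux3 (fun u s => k (u - s) * h s)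
    0 (fun x => x) t 1) as H.
  replace (k 0 * h t + conv dk h t) with
    (RInt (fun s => Derive (fun u => k (u - s) * h s) t) 0 t + k (t - t) * h t * 1).
  - apply H; auto.
    + apply filter_forall. auto.
    + exists (mkposreal 1 Rlt_0_1). apply filter_forall. auto.
    + apply (is_derive_id (K := R_AbsRing)).
    + exists (mkposreal 1 Rlt_0_1). apply filter_forall. intros x s _. eexists. apply Hd.
    + apply locally_2d_forall. auto.
    + apply continuity_pt_filterlim. now apply continuous_conv_integrand.
  - rewrite Rminus_diag. unfold conv.
    rewrite (RInt_ext _ (fun s => dk (t - s) * h s)).
    + ring.
    + intros s _. now apply is_derive_unique.
Qed.

Lemma conv_bound (k h : R -> R) (T Bk Bh t : R) :
  (forall x, continuous k x) -> (forall x, continuous h x) -> 0 <= t <= T ->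
  (forall s, 0 <= s <= T -> Rabs (k s) <= Bk) ->
  (forall s, 0 <= s <= T -> Rabs (h s) <= Bh) ->
  Rabs (conv k h t) <= T * (Bk * Bh).
Proof.
  intros Hk Hh Ht HBk HBh. unfold conv.
  assert (0 <= Bk) by (apply Rle_trans with (2 := HBk t Ht); apply Rabs_pos).
  assert (0 <= Bh) by (apply Rle_trans with (2 := HBh t Ht); apply Rabs_pos).
  apply Rle_trans with ((t - 0) * (Bk * Bh)).
  - apply abs_RInt_le_const; [lra| |].
    + apply ex_RInt_cont. intros x. now apply continuous_conv_integrand.
    + intros s Hs. rewrite Rabs_mult.
      apply Rmult_le_compat; try apply Rabs_pos; [apply HBk | apply HBh]; lra.
  - apply Rmult_le_compat_r; [nra | lra].
Qed.

(** * The amplitude of a mode *)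

Section Amplitude.
Variables (tau a b T : R) (N : nat).
Hypothesis tau_gt0 : 0 < tau.
Hypothesis T_gt0 : 0 < T.
Hypothesis TN : T <= (INR N + 1) * tau.
Variables (Phi F : R -> R) (Phi1 : R).
Hypothesis Phi_cont : continuous_on (fun t => - tau <= t <= 0) Phi.
Hypothesis F_cont : continuous_on (fun t => 0 <= t <= T) F.

Let sK := sinK tau a b N.
Let cK := cosK tau a b N.
Let dK := dcosK tau a b N.

(** Extending the history [Phi] by the constant [Phi 0] after time 0 removes the jump that its
    extension by zero may have at [t = tau]. What the constant adds to the delayed term,
    together with [a * Phi 0], accounts for the difference between [cosK] and 1. *)
Definition forcing (t : R) : R :=
  a * Phi 0 + b * Phi (clamp (- tau) 0 (t - tau)) + F (clamp 0 T t).
(** The amplitude of a mode as a constant, a multiple of the sine kernel and one convolution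
    with a continuous forcing; this form is twice continuously differentiable at sight. *)
Definition ampl (t : R) : R := Phi 0 + Phi1 * sK t + conv sK forcing t.
Definition ampl1 (t : R) : R := Phi1 * cK t + conv cK forcing t.
Definition ampl2 (t : R) : R := Phi1 * dK t + forcing t + conv dK forcing t.

Lemma continuous_history (t : R) :
  continuous (fun t => Phi (clamp (- tau) 0 (t - tau))) t.
Proof.
  apply (continuous_comp (fun t => t - tau) (fun s => Phi (clamp (- tau) 0 s))).
  - apply (ex_derive_continuous (V := R_NormedModule)). auto_derive; auto.
  - apply continuous_on_clamp; [lra | exact Phi_cont].
Qed.

Lemma continuous_source (t : R) : continuous (fun t => F (clamp 0 T t)) t.
Proof. apply continuous_on_clamp; [lra | exact F_cont]. Qed.

Lemma continuous_forcing (t : R) : continuous forcing t.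
Proof.
  apply (continuous_plus (V := R_NormedModule)
    (fun t => a * Phi 0 + b * Phi (clamp (- tau) 0 (t - tau)))); [|apply continuous_source].
  apply (continuous_plus (V := R_NormedModule) (fun _ => a * Phi 0)).
  - apply continuous_const.
  - apply (continuous_scal_r (V := R_NormedModule) b
      (fun t => Phi (clamp (- tau) 0 (t - tau)))), continuous_history.
Qed.

Lemma is_derive_ampl (t : R) : is_derive ampl t (ampl1 t).
Proof.
  pose proof (is_derive_conv sK cK forcing t (is_derive_sinK tau a b N)
    (continuous_cosK tau a b N) continuous_forcing) as H.
  pose proof (is_derive_sinK tau a b N t) as Hs. fold sK cK in Hs.
  replace (ampl1 t) with (plus (Phi1 * cK t) (sK 0 * forcing t + conv cK forcing t)).
  - apply (is_derive_plus (fun t => Phi 0 + Phi1 * sK t)); [|exact H].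
    auto_derive; [eexists; exact Hs|].
    replace (Derive (fun x => sK x) t) with (cK t) by (symmetry; now apply is_derive_unique).
    ring.
  - unfold ampl1, sK. rewrite sinK_0 by exact tau_gt0. unfold plus; simpl. ring.
Qed.

Lemma is_derive_ampl1 (t : R) : is_derive ampl1 t (ampl2 t).
Proof.
  pose proof (is_derive_conv cK dK forcing t (is_derive_cosK tau a b N)
    (continuous_dcosK tau a b N) continuous_forcing) as H.
  pose proof (is_derive_cosK tau a b N t) as Hs. fold cK dK in Hs.
  replace (ampl2 t) with (plus (Phi1 * dK t) (cK 0 * forcing t + conv dK forcing t)).
  - apply (is_derive_plus (fun t => Phi1 * cK t)); [|exact H].
    now apply is_derive_scal.
  - unfold ampl2, cK. rewrite cosK_0 by exact tau_gt0. unfold plus; simpl. ring.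
Qed.

Lemma continuous_ampl2 (t : R) : continuous ampl2 t.
Proof.
  apply (continuous_plus (V := R_NormedModule) (fun t => Phi1 * dK t + forcing t)).
  - apply (continuous_plus (V := R_NormedModule) (fun t => Phi1 * dK t)).
    + apply (continuous_scal_r (V := R_NormedModule) Phi1 dK), continuous_dcosK.
    + apply continuous_forcing.
  - apply continuous_conv; [apply continuous_dcosK | apply continuous_forcing].
Qed.

Let sP (t : R) : R := sK (pos_part t).

Lemma continuous_sP (t : R) : continuous sP t.
Proof.
  apply (continuous_comp pos_part sK); [apply pos_part_continuous | apply continuous_sinK].
Qed.

Lemma continuous_sP_shift (t : R) : continuous (fun s => sP (s - tau)) t.
Proof.
  apply (continuous_comp (fun s => s - tau) sP); [|apply continuous_sP].
  apply (ex_derive_continuous (V := R_NormedModule)). auto_derive; auto.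
Qed.

Lemma sP_nonpos (t : R) : t <= 0 -> sP t = 0.
Proof. intros Ht. unfold sP, pos_part. rewrite Rmax_left by auto. now apply sinK_0. Qed.

Lemma sP_nonneg (t : R) : 0 <= t -> sP t = sK t.
Proof. intros Ht. unfold sP, pos_part. now rewrite Rmax_right. Qed.

(** The delayed equation of [dcosK_eq], integrated from 0. *)
Lemma cosK_integral (t : R) : 0 <= t <= T ->
  cK t = 1 + a * RInt (fun s => sK (t - s)) 0 t + b * RInt (fun s => sP (s - tau)) 0 t.
Proof.
  intros Ht.
  assert (H : RInt dK 0 t = cK t - cK 0).
  { apply is_RInt_unique. apply (is_RInt_derive (V := R_CompleteNormedModule)).
    - intros x _. apply is_derive_cosK.
    - intros x _. apply continuous_dcosK. }
  rewrite (RInt_ext dK (fun s => a * sK s + b * sP (s - tau))) in H.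
  - rewrite RInt_lin in H; [|apply continuous_sinK | apply continuous_sP_shift].
    rewrite (RInt_reflect sK t 0 t) by apply continuous_sinK.
    rewrite Rminus_diag, Rminus_0_r.
    unfold cK in H at 2. rewrite cosK_0 in H by exact tau_gt0. lra.
  - intros s Hs. rewrite Rmin_left, Rmax_right in Hs by lra.
    apply (dcosK_eq tau a b N tau_gt0). lra.
Qed.

(** For [s > tau] the extended history is constant, and that part of the convolution is
    [Phi 0] times an integral of the sine kernel alone, by reflection of the variable. *)
Lemma history_integral (t : R) : 0 <= t ->
  RInt (fun s => sP (t - tau - s) * Phi s) (- tau) 0
    + Phi 0 * RInt (fun s => sP (s - tau)) 0 t
  = conv sK (fun s => Phi (clamp (- tau) 0 (s - tau))) t.
Proof.
  intros Ht. set (P := fun s => Phi (clamp (- tau) 0 (s - tau))).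
  assert (HPc : forall s, continuous P s) by apply continuous_history.
  assert (HI : forall s, continuous (fun s => sP (t - s) * P s) s).
  { intros s. apply continuous_conv_integrand; [apply continuous_sP | exact HPc]. }
  assert (E1 : conv sK P t = RInt (fun s => sP (t - s) * P s) 0 t).
  { apply RInt_ext. intros s Hs. rewrite Rmin_left, Rmax_right in Hs by lra.
    rewrite sP_nonneg by lra. reflexivity. }
  rewrite E1.
  rewrite (RInt_split (fun s : R => sP (t - s) * P s) 0 tau t HI).
  f_equal.
  - pose proof (RInt_comp_lin (V := R_CompleteNormedModule)
      (fun s : R => sP (t - s) * P s) 1 tau (- tau) 0 (ex_RInt_cont _ _ _ HI)) as E.
    replace (1 * - tau + tau) with 0 in E by ring. replace (1 * 0 + tau) with tau in E by ring.
    rewrite <- E. apply RInt_ext. intros s Hs.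
    rewrite Rmin_left, Rmax_right in Hs by lra. unfold P.
    replace (1 * s + tau - tau) with s by ring. rewrite clamp_id by lra.
    replace (t - (1 * s + tau)) with (t - tau - s) by ring.
    unfold scal; simpl; unfold mult; simpl. ring.
  - assert (E0 : RInt (fun s => sP (s - tau)) 0 tau = 0).
    { rewrite (RInt_ext _ (fun _ => 0)).
      - rewrite RInt_const. apply Rmult_0_r.
      - intros s Hs. rewrite Rmin_left, Rmax_right in Hs by lra. apply sP_nonpos. lra. }
    rewrite (RInt_split (fun s : R => sP (s - tau)) 0 tau t continuous_sP_shift), E0, Rplus_0_l.
    pose proof (RInt_reflect (fun s => sP (s - tau)) (t + tau) tau t continuous_sP_shift) as E.
    replace (t + tau - t) with tau in E by ring. replace (t + tau - tau) with t in E by ring.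
    rewrite <- E.
    assert (Hc : forall z, continuous (fun s => sP (t + tau - s - tau)) z).
    { intros z. apply (continuous_comp (fun s => t + tau - s) (fun s => sP (s - tau)));
        [|apply continuous_sP_shift].
      apply (ex_derive_continuous (V := R_NormedModule)). auto_derive; auto. }
    assert (E2 : RInt (fun s => Phi 0 * sP (t + tau - s - tau)) tau t
      = Phi 0 * RInt (fun s => sP (t + tau - s - tau)) tau t)
      by (apply (RInt_scal (V := R_CompleteNormedModule)); now apply ex_RInt_cont).
    rewrite <- E2. apply RInt_ext. intros s Hs.
    replace (t + tau - s - tau) with (t - s) by ring.
    destruct (Rle_dec s t) as [Hst|Hst].
    + assert (Hs' : tau <= s).
      { revert Hs. unfold Rmin, Rmax. destruct (Rle_dec tau t); lra. }
      unfold P, clamp. rewrite (Rmin_left 0), Rmax_right by lra. apply Rmult_comm.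
    + rewrite sP_nonpos by lra. rewrite Rmult_0_r, Rmult_0_l. reflexivity.
Qed.

(** The solution formula with the delayed cosine, the delayed sine and two integrals is [ampl]:
    replace the cosine by [cosK_integral] and merge the history by [history_integral]. *)
Lemma ampl_eq (t : R) : 0 <= t <= T ->
  delayC tau a b t * Phi 0 + delayS tau a b t * Phi1
  + b * RInt (fun s => delayS tau a b (t - tau - s) * Phi s) (- tau) 0
  + RInt (fun s => delayS tau a b (t - s) * F s) 0 t = ampl t.
Proof.
  intros Ht.
  rewrite delayC_cosK with (N := N), delayS_sinK with (N := N) by (auto; lra).
  replace (pos_part t) with t by (unfold pos_part; rewrite Rmax_right; lra).
  fold cK sK. rewrite (cosK_integral t Ht).
  assert (I1 : RInt (fun s => delayS tau a b (t - tau - s) * Phi s) (- tau) 0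
    = RInt (fun s => sP (t - tau - s) * Phi s) (- tau) 0).
  { apply RInt_ext. intros s Hs. rewrite Rmin_left, Rmax_right in Hs by lra.
    rewrite delayS_sinK with (N := N) by (auto; lra). reflexivity. }
  assert (I2 : RInt (fun s => delayS tau a b (t - s) * F s) 0 t
    = RInt (fun s => sK (t - s) * F (clamp 0 T s)) 0 t).
  { apply RInt_ext. intros s Hs. rewrite Rmin_left, Rmax_right in Hs by lra.
    rewrite delayS_sinK with (N := N) by (auto; lra).
    rewrite clamp_id by lra. fold sK. change (sK (pos_part (t - s))) with (sP (t - s)).
    now rewrite sP_nonneg by lra. }
  rewrite I1, I2.
  pose proof (history_integral t (proj1 Ht)) as Hh.
  unfold ampl.
  assert (E : conv sK forcing t = a * Phi 0 * RInt (fun s => sK (t - s)) 0 t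
     + b * conv sK (fun s => Phi (clamp (- tau) 0 (s - tau))) t
     + RInt (fun s => sK (t - s) * F (clamp 0 T s)) 0 t).
  { unfold conv, forcing.
    assert (H1 : forall z, continuous (fun s => sK (t - s)) z).
    { intros z. apply (continuous_comp (fun s => t - s) sK); [|apply continuous_sinK].
      apply (ex_derive_continuous (V := R_NormedModule)). auto_derive; auto. }
    assert (H2 : forall z, continuous (fun s => sK (t - s) * Phi (clamp (- tau) 0 (s - tau))) z).
    { intros z. apply continuous_conv_integrand;
        [apply continuous_sinK | apply continuous_history]. }
    assert (H3 : forall z, continuous (fun s => sK (t - s) * F (clamp 0 T s)) z).
    { intros z. apply continuous_conv_integrand;
        [apply continuous_sinK | apply continuous_source]. }
    rewrite <- RInt_lin by auto.
    match goal with |- _ = ?u + ?w => replace (u + w) with (1 * u + 1 * w) by ring end.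
    rewrite <- RInt_lin; auto.
    - apply RInt_ext. intros s _.
      match goal with |- @eq _ ?u ?v => change (@eq R u v) end. ring.
    - intros z. apply (continuous_plus (V := R_NormedModule)).
      + apply (continuous_scal_r (V := R_NormedModule) (a * Phi 0) (fun s => sK (t - s))), H1.
      + apply (continuous_scal_r (V := R_NormedModule) b
          (fun s => sK (t - s) * Phi (clamp (- tau) 0 (s - tau)))), H2. }
  rewrite E, <- Hh. ring.
Qed.

End Amplitude.

(** * Energy growth of the kernels over the delay steps *)

Lemma exp_le_mono (x y : R) : x <= y -> exp x <= exp y.
Proof.
  intros [H| ->]; [left; now apply exp_increasing | lra].
Qed.

(** The energy of the undelayed oscillator [S'' = - w S] of frequency [sqrt w]. *)
Definition energy (tau w b : R) (N : nat) (t : R) : R :=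
  cosK tau (- w) b N t ^ 2 + w * sinK tau (- w) b N t ^ 2.

(** Without delay the energy is constant; with it, [E' = 2 C z <= E + z^2] where [z] is the delayed
    term. Gronwall's argument then says that [exp (-t) E - t Q] is nonincreasing. *)
Lemma energy_step (tau w b Q t1 : R) (N : nat) :
  0 < tau -> 0 <= w -> t1 <= (INR N + 1) * tau ->
  (forall t, 0 <= t <= t1 -> (b * sinK tau (- w) b N (pos_part (t - tau))) ^ 2 <= Q) ->
  forall t, 0 <= t <= t1 -> energy tau w b N t <= exp t * (1 + t * Q).
Proof.
  intros Htau Hw Ht1 HQ t Ht.
  set (sK := sinK tau (- w) b N). set (cK := cosK tau (- w) b N).
  set (dK := dcosK tau (- w) b N).
  (* nonincreasing by the energy inequality, with value 1 at 0 *)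
  set (g := fun t => exp (- t) * energy tau w b N t - t * Q).
  set (dg := fun t => exp (- t) *
    (2 * cK t * dK t + w * (2 * sK t * cK t) - energy tau w b N t) - Q).
  assert (Hg : forall s, is_derive g s (dg s)).
  { intros s. pose proof (is_derive_sinK tau (- w) b N s) as H1.
    pose proof (is_derive_cosK tau (- w) b N s) as H2. fold sK cK dK in H1, H2.
    unfold g, energy. fold sK cK. auto_derive.
    - repeat split; eexists; eauto.
    - replace (Derive (fun x => sK x) s) with (cK s) by (symmetry; now apply is_derive_unique).
      replace (Derive (fun x => cK x) s) with (dK s) by (symmetry; now apply is_derive_unique).
      unfold dg, energy. fold sK cK. ring. }
  assert (Hle : g t <= g 0).
  { destruct (MVT_gen g 0 t dg) as [c [Hc E]].
    - intros; apply Hg.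
    - intros s _. apply continuity_pt_filterlim.
      apply (ex_derive_continuous (V := R_NormedModule)). eexists. apply Hg.
    - rewrite Rmin_left, Rmax_right in Hc by lra.
      assert (dg c <= 0); [|nra].
      unfold dg, dK, energy. rewrite dcosK_eq by lra. fold sK cK.
      pose proof (HQ c ltac:(lra)) as HQc. fold sK in HQc.
      set (z := b * sK (pos_part (c - tau))) in *.
      assert (He : exp (- c) <= 1) by (rewrite <- exp_0; apply exp_le_mono; lra).
      pose proof (exp_pos (- c)) as He0.
      assert (Hz : 2 * cK c * (- w * sK c + z) + w * (2 * sK c * cK c)
         - (cK c ^ 2 + w * sK c ^ 2) <= Q).
      { pose proof (pow2_ge_0 (cK c - z)). pose proof (pow2_ge_0 (sK c)). nra. }
      assert (0 <= Q) by (pose proof (pow2_ge_0 z); lra).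
      nra. }
  unfold g in Hle. rewrite Ropp_0, exp_0 in Hle.
  replace (energy tau w b N 0) with 1 in Hle.
  2:{ unfold energy. rewrite cosK_0, sinK_0 by auto. ring. }
  assert (H : exp (- t) * energy tau w b N t <= 1 + t * Q) by lra.
  apply (Rmult_le_compat_l (exp t)) in H; [|left; apply exp_pos].
  rewrite <- Rmult_assoc, <- exp_plus, Rplus_opp_r, exp_0, Rmult_1_l in H. exact H.
Qed.

(** Step by step in [m]: on the step that ends at [(m + 1) tau] the delayed term only sees the
    preceding steps, where [S^2 <= E / w]. With [b] and [w] both of the order [x^2], its square is
    at most of the order [x^2 E], so that each delay step costs a factor [x^2] of energy. *)
Lemma energy_growth (tau r B : R) (N : nat) : 0 < tau -> 0 < r ->
  forall m, (m <= N)%nat -> exists D, 0 <= D /\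
  forall x w b t, 1 <= x -> r * x ^ 2 <= w -> Rabs b <= B * x ^ 2 ->
    0 <= t <= INR (S m) * tau -> energy tau w b N t <= D * x ^ (2 * m).
Proof.
  intros Htau Hr. induction m as [|m IH].
  - intros _. exists (exp tau). split; [left; apply exp_pos|].
    intros x w b t Hx Hw Hb Ht. simpl INR in Ht. rewrite Rmult_1_l in Ht.
    assert (0 <= w) by nra. simpl (x ^ _). rewrite Rmult_1_r.
    apply Rle_trans with (exp t * (1 + t * 0)).
    + apply (energy_step tau w b 0 tau); auto.
      * pose proof (pos_INR N). nra.
      * intros s Hs. unfold pos_part. rewrite Rmax_left, sinK_0 by lra. lra.
    + rewrite Rmult_0_r, Rplus_0_r, Rmult_1_r. apply exp_le_mono. lra.
  - intros HmN. destruct IH as [D [HD IH]]; [lia|].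
    set (T := INR (S (S m)) * tau).
    assert (HT : 0 <= T) by (pose proof (pos_INR (S (S m))); unfold T; nra).
    assert (HD' : 0 <= B ^ 2 * D / r).
    { apply Rdiv_le_0_compat; auto. apply Rmult_le_pos; auto. apply pow2_ge_0. }
    exists (exp T * (1 + T * (B ^ 2 * D / r))). split.
    { apply Rmult_le_pos; [left; apply exp_pos|]. clear - HT HD'.
      pose proof (Rmult_le_pos _ _ HT HD'). lra. }
    intros x w b t Hx Hw Hb Ht. assert (Hw0 : 0 < w).
    { apply Rlt_le_trans with (r * x ^ 2); [apply Rmult_lt_0_compat; [|apply pow_lt]|]; lra. }
    set (y := x ^ (2 * S m)).
    assert (Hy : y = x ^ 2 * x ^ (2 * m)).
    { unfold y. rewrite <- pow_add. f_equal. lia. }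
    assert (Hy1 : 1 <= y) by now apply pow_R1_Rle.
    assert (Hstep : energy tau w b N t <= exp t * (1 + t * (B ^ 2 * D / r * y))).
    { apply (energy_step tau w b _ T); auto; try lra.
      - unfold T. apply Rmult_le_compat_r; [lra|]. rewrite <- S_INR. apply le_INR. lia.
      - intros s Hs.
        assert (Hp : 0 <= pos_part (s - tau) <= INR (S m) * tau).
        { unfold T in Hs. rewrite S_INR in Hs. pose proof (pos_INR (S m)).
          unfold pos_part. split; [apply Rmax_l|]. apply Rmax_lub; nra. }
        pose proof (IH x w b _ Hx Hw Hb Hp) as HE. unfold energy in HE.
        set (z := sinK tau (- w) b N (pos_part (s - tau))) in *.
        pose proof (pow2_ge_0 (cosK tau (- w) b N (pos_part (s - tau)))) as Hc.
        assert (Hz : r * x ^ 2 * z ^ 2 <= D * x ^ (2 * m)).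
        { pose proof (pow2_ge_0 z). nra. }
        assert (Hb2 : b ^ 2 <= B ^ 2 * x ^ 2 * x ^ 2).
        { rewrite <- (pow2_abs b). replace (B ^ 2 * x ^ 2 * x ^ 2) with ((B * x ^ 2) ^ 2) by ring.
          apply pow_incr. split; [apply Rabs_pos | exact Hb]. }
        rewrite Rpow_mult_distr.
        apply Rle_trans with (B ^ 2 * x ^ 2 * x ^ 2 * z ^ 2).
        + apply Rmult_le_compat_r; auto. apply pow2_ge_0.
        + rewrite Hy. apply Rmult_le_reg_l with r; auto.
          replace (r * (B ^ 2 * D / r * (x ^ 2 * x ^ (2 * m))))
            with (B ^ 2 * x ^ 2 * (D * x ^ (2 * m))) by (field; lra).
          replace (r * (B ^ 2 * x ^ 2 * x ^ 2 * z ^ 2))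
            with (B ^ 2 * x ^ 2 * (r * x ^ 2 * z ^ 2)) by ring.
          apply Rmult_le_compat_l; auto.
          apply Rmult_le_pos; apply pow2_ge_0. }
    apply Rle_trans with (1 := Hstep). rewrite Rmult_assoc.
    apply Rmult_le_compat.
    + left; apply exp_pos.
    + assert (0 <= B ^ 2 * D / r * y) by nra. nra.
    + apply exp_le_mono. fold T in Ht. lra.
    + assert (0 <= B ^ 2 * D / r * y) by nra. fold T in Ht.
      assert (t * (B ^ 2 * D / r * y) <= T * (B ^ 2 * D / r * y))
        by (apply Rmult_le_compat_r; lra).
      lra.
Qed.

Lemma abs_le_of_sqr (z D y : R) : 0 <= D -> 0 <= y -> z ^ 2 <= D * y ^ 2 ->
  Rabs z <= (1 + D) * y.
Proof.
  intros HD Hy Hz. apply Rsqr_incr_0; [|apply Rabs_pos | nra].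
  rewrite <- Rsqr_abs. unfold Rsqr. nra.
Qed.

(** The energy bound at the last step, read off for the kernel and its first two derivatives;
    each derivative costs one power of the frequency [x]. *)
Lemma kernel_growth (tau r B : R) (N : nat) : 0 < tau -> 0 < r -> 0 <= B ->
  (1 <= N)%nat -> exists A, 0 <= A /\
  forall x w b t, 1 <= x -> r * x ^ 2 <= w <= B * x ^ 2 -> Rabs b <= B * x ^ 2 ->
    0 <= t <= INR N * tau ->
    x ^ 2 * Rabs (sinK tau (- w) b N t) <= A * x ^ N /\
    x * Rabs (cosK tau (- w) b N t) <= A * x ^ N /\
    Rabs (dcosK tau (- w) b N t) <= A * x ^ N.
Proof.
  intros Htau Hr HB HN. destruct N as [|M]; [lia|].
  destruct (energy_growth tau r B (S M) Htau Hr M ltac:(lia)) as [D [HD HE]].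
  set (A1 := 1 + D). set (A2 := 1 + D / r).
  assert (HDr : 0 <= D / r) by now apply Rdiv_le_0_compat.
  exists (A1 + A2 + 2 * B * A2). split; [unfold A1, A2; nra|].
  intros x w b t Hx Hw Hb Ht. assert (Hw0 : 0 < w).
    { apply Rlt_le_trans with (r * x ^ 2); [apply Rmult_lt_0_compat; [|apply pow_lt]|]; lra. }
  assert (HxN : 0 <= x ^ S M) by (apply pow_le; lra).
  assert (HxN2 : (x ^ S M) ^ 2 = x ^ 2 * x ^ (2 * M)).
  { rewrite <- pow_mult, <- pow_add. f_equal. lia. }
  assert (Hs : forall t, 0 <= t <= INR (S M) * tau ->
     x ^ 2 * Rabs (sinK tau (- w) b (S M) t) <= A2 * x ^ S M).
  { intros s Hs. rewrite <- (Rabs_pos_eq (x ^ 2)) by apply pow2_ge_0. rewrite <- Rabs_mult.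
    apply abs_le_of_sqr; auto. rewrite HxN2.
    pose proof (HE x w b s Hx (proj1 Hw) Hb Hs) as H. unfold energy in H.
    set (z := sinK tau (- w) b (S M) s) in *.
    pose proof (pow2_ge_0 (cosK tau (- w) b (S M) s)) as Hc. pose proof (pow2_ge_0 z) as Hz0.
    assert (Hz : r * x ^ 2 * z ^ 2 <= D * x ^ (2 * M)) by nra.
    apply Rmult_le_reg_l with r; auto.
    replace (r * (D / r * (x ^ 2 * x ^ (2 * M)))) with (x ^ 2 * (D * x ^ (2 * M))) by (field; lra).
    replace (r * (x ^ 2 * z) ^ 2) with (x ^ 2 * (r * x ^ 2 * z ^ 2)) by ring.
    apply Rmult_le_compat_l; auto. apply pow2_ge_0. }
  assert (HA1 : 0 <= A1 * x ^ S M) by (unfold A1; nra).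
  assert (HA2 : 0 <= A2 * x ^ S M) by (unfold A2; nra).
  assert (HBA : 0 <= B * (A2 * x ^ S M)) by nra.
  repeat split.
  - pose proof (Hs t Ht). nra.
  - apply Rle_trans with (A1 * x ^ S M); [|nra].
    rewrite <- (Rabs_pos_eq x) at 1 by lra. rewrite <- Rabs_mult.
    apply abs_le_of_sqr; auto. rewrite HxN2.
    pose proof (HE x w b t Hx (proj1 Hw) Hb Ht) as H. unfold energy in H.
    set (z := cosK tau (- w) b (S M) t) in *.
    pose proof (pow2_ge_0 (sinK tau (- w) b (S M) t)) as Hc.
    replace ((x * z) ^ 2) with (x ^ 2 * z ^ 2) by ring.
    replace (D * (x ^ 2 * x ^ (2 * M))) with (x ^ 2 * (D * x ^ (2 * M))) by ring.
    apply Rmult_le_compat_l; [apply pow2_ge_0 | nra].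
  - rewrite dcosK_eq by (auto; pose proof (pos_INR (S M)); nra).
    assert (Hp : 0 <= pos_part (t - tau) <= INR (S M) * tau).
    { unfold pos_part. split; [apply Rmax_l|]. apply Rmax_lub; nra. }
    pose proof (Hs t Ht) as H1. pose proof (Hs _ Hp) as H2.
    eapply Rle_trans; [apply Rabs_triang|]. rewrite !Rabs_mult, Rabs_Ropp, (Rabs_pos_eq w) by lra.
    set (z1 := Rabs (sinK _ _ _ _ t)) in *. set (z2 := Rabs (sinK _ _ _ _ (pos_part _))) in *.
    assert (0 <= z1) by apply Rabs_pos. assert (0 <= z2) by apply Rabs_pos.
    assert (w * z1 <= B * (A2 * x ^ S M)).
    { apply Rle_trans with (B * (x ^ 2 * z1)); nra. }
    assert (Rabs b * z2 <= B * (A2 * x ^ S M)).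
    { apply Rle_trans with (B * (x ^ 2 * z2)); nra. }
    nra.
Qed.

(** * Continuity on rectangles *)

Lemma continuous2_on_eps (D : R -> R -> Prop) (w : R -> R -> R) :
  continuous2_on D w <->
  forall t x, D t x -> forall eps, 0 < eps -> exists d : posreal,
    forall t' x', Rabs (t' - t) < d -> Rabs (x' - x) < d -> D t' x' ->
      Rabs (w t' x' - w t x) < eps.
Proof.
  split.
  - intros H t x Hx eps Heps.
    destruct (proj1 (filterlim_R _ _ _) (H (t, x) Hx) eps Heps) as [d Hd].
    exists d. intros t' x' Ht Hx' HD. apply (Hd (t', x')); [split|]; assumption.
  - intros H [t x] Hx. apply filterlim_R; [typeclasses eauto|]. intros eps Heps.
    destruct (H t x Hx eps Heps) as [d Hd]. exists d. intros [t' x'] [Ht Hx'] HD.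
    now apply Hd.
Qed.

Lemma continuous2_on_subset (D D' : R -> R -> Prop) (w : R -> R -> R) :
  (forall t x, D' t x -> D t x) -> continuous2_on D w -> continuous2_on D' w.
Proof.
  intros HD H. apply continuous2_on_eps. intros t x Hx eps Heps.
  destruct (proj1 (continuous2_on_eps D w) H t x (HD _ _ Hx) eps Heps) as [d Hd].
  exists d. auto.
Qed.

Lemma continuous2_on_ext (D : R -> R -> Prop) (w w' : R -> R -> R) :
  (forall t x, D t x -> w t x = w' t x) -> continuous2_on D w -> continuous2_on D w'.
Proof.
  intros He H. apply continuous2_on_eps. intros t x Hx eps Heps.
  destruct (proj1 (continuous2_on_eps D w) H t x Hx eps Heps) as [d Hd].
  exists d. intros t' x' Ht' Hx' HD. rewrite <- !He by auto. auto.
Qed.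

Lemma continuous2_on_plus (D : R -> R -> Prop) (w w' : R -> R -> R) :
  continuous2_on D w -> continuous2_on D w' ->
  continuous2_on D (fun t x => w t x + w' t x).
Proof.
  intros H H' p Hp. eapply filterlim_comp_2; [exact (H p Hp) | exact (H' p Hp) |].
  apply (filterlim_plus (V := R_NormedModule)).
Qed.

Lemma continuous2_on_mult (D : R -> R -> Prop) (w w' : R -> R -> R) :
  continuous2_on D w -> continuous2_on D w' ->
  continuous2_on D (fun t x => w t x * w' t x).
Proof.
  intros H H' p Hp. eapply filterlim_comp_2; [exact (H p Hp) | exact (H' p Hp) |].
  apply (filterlim_mult (K := R_AbsRing)).
Qed.

Lemma continuous2_on_const (D : R -> R -> Prop) (c : R) : continuous2_on D (fun _ _ => c).
Proof. intros p Hp. apply filterlim_const. Qed.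

Lemma continuous2_on_fst (D : R -> R -> Prop) (I : R -> Prop) (g : R -> R) :
  (forall t x, D t x -> I t) -> continuous_on I g -> continuous2_on D (fun t _ => g t).
Proof.
  intros HD Hg. apply continuous2_on_eps. intros t x Hx eps Heps.
  destruct (proj1 (filterlim_R _ _ _) (Hg t (HD _ _ Hx)) eps Heps) as [d Hd].
  exists d. intros t' x' Ht _ HDx. apply Hd; [exact Ht | now apply (HD t' x')].
Qed.

Lemma continuous2_on_snd (D : R -> R -> Prop) (g : R -> R) :
  (forall x, continuous g x) -> continuous2_on D (fun _ x => g x).
Proof.
  intros Hg. apply continuous2_on_eps. intros t x Hx eps Heps.
  destruct (proj1 (filterlim_R _ _ _) (Hg x) eps Heps) as [d Hd].
  exists d. intros t' x' _ Hx' _. now apply Hd.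
Qed.

Lemma continuous2_on_lift (a b c d L : R) (g1 g2 : R -> R) :
  continuous_on (fun t => a <= t <= b) g1 -> continuous_on (fun t => a <= t <= b) g2 ->
  continuous2_on (rect a b c d) (boundary_lift L g1 g2).
Proof.
  intros H1 H2.
  assert (HD : forall t x, rect a b c d t x -> a <= t <= b) by (intros t x H; apply H).
  apply continuous2_on_ext with (fun t x => g1 t + x / L * (g2 t + -1 * g1 t)).
  { intros t x _. unfold boundary_lift. ring. }
  apply continuous2_on_plus; [apply continuous2_on_fst with (1 := HD); exact H1|].
  apply continuous2_on_mult.
  - apply (continuous2_on_snd _ (fun x => x / L)). intros x.
    apply (continuous_mult (K := R_AbsRing)); [apply continuous_id | apply continuous_const].
  - apply continuous2_on_plus; [apply continuous2_on_fst with (1 := HD); exact H2|].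
    apply continuous2_on_mult; [apply continuous2_on_const|].
    apply continuous2_on_fst with (1 := HD); exact H1.
Qed.

Lemma continuous_on_shift (a b c d s : R) (g : R -> R) :
  (forall t, c <= t <= d -> a <= t - s <= b) ->
  continuous_on (fun t => a <= t <= b) g ->
  continuous_on (fun t => c <= t <= d) (fun t => g (t - s)).
Proof.
  intros Hs Hg t Ht. apply filterlim_R; [typeclasses eauto|]. intros eps Heps.
  destruct (proj1 (filterlim_R _ _ _) (Hg (t - s) (Hs t Ht)) eps Heps) as [e He].
  exists e. refine (fun (y : R) Hy Hyd => _). apply He; [|now apply Hs].
  change (Rabs (y - s - (t - s)) < e). replace (y - s - (t - s)) with (y - t) by ring.
  exact Hy.
Qed.

(** The integrand is clamped in both variables to become continuous on the whole plane. *)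
Lemma continuous_sine_coeff (a b L : R) (w : R -> R -> R) (n : nat) :
  a <= b -> 0 < L -> continuous2_on (rect a b 0 L) w ->
  continuous_on (fun t => a <= t <= b) (sine_coeff L w n).
Proof.
  intros Hab HL Hw.
  set (W := fun t s => w (clamp a b t) (clamp 0 L s) * sin (INR n * PI / L * s)).
  assert (HW : forall t s, continuity_2d_pt W t s).
  { intros t s. apply continuity_2d_pt_mult.
    - intros eps.
      destruct (proj1 (continuous2_on_eps _ w) Hw (clamp a b t) (clamp 0 L s)
        (conj (clamp_in a b t Hab) (clamp_in 0 L s (Rlt_le _ _ HL))) eps (cond_pos eps)) as [d Hd].
      exists d. intros t' s' Ht Hs. apply Hd.
      + eapply Rle_lt_trans; [apply clamp_lip | exact Ht].
      + eapply Rle_lt_trans; [apply clamp_lip | exact Hs].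
      + split; apply clamp_in; lra.
    - apply (continuity_1d_2d_pt_comp (fun s => sin (INR n * PI / L * s)) (fun _ v => v)).
      + apply continuity_pt_filterlim.
        apply (ex_derive_continuous (V := R_NormedModule) (fun s => sin (INR n * PI / L * s))).
        auto_derive; auto.
      + apply continuity_2d_pt_id2. }
  assert (Hc : forall t, continuous (fun t => 2 / L * RInt (W t) 0 L) t).
  { intros t. apply (continuous_scal_r (V := R_NormedModule) (2 / L) (fun t => RInt (W t) 0 L)).
    apply continuous_RInt_param; [lra | exact HW]. }
  intros t Ht. apply filterlim_within_ext with (f := fun t => 2 / L * RInt (W t) 0 L).
  - intros s Hs. unfold sine_coeff. f_equal. apply RInt_ext. intros x Hx.
    rewrite Rmin_left, Rmax_right in Hx by lra. unfold W. now rewrite !clamp_id by lra.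
  - replace (sine_coeff L w n t) with (2 / L * RInt (W t) 0 L).
    + intros P HP. specialize (Hc t P HP). unfold filtermap, within in *.
      revert Hc. apply filter_imp. auto.
    + unfold sine_coeff. f_equal. apply RInt_ext. intros x Hx.
      rewrite Rmin_left, Rmax_right in Hx by lra. unfold W. now rewrite !clamp_id by lra.
Qed.

(** Continuity makes the maximum exist, so that the description operator in [max_abs] returns it. *)
Lemma le_max_abs (a b : R) (g : R -> R) (s : R) : a <= s <= b ->
  continuous_on (fun t => a <= t <= b) g -> Rabs (g s) <= max_abs a b g.
Proof.
  intros Hs Hg.
  destruct (continuity_ab_maj (fun t => Rabs (g (clamp a b t))) a b ltac:(lra)) as [m [Hm1 Hm2]].
  { intros c _. apply continuity_pt_filterlim.
    apply (continuous_comp (fun t => g (clamp a b t)) Rabs).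
    - apply continuous_on_clamp; [lra | exact Hg].
    - apply continuous_Rabs. }
  assert (E : max_abs a b g = Rabs (g m)).
  { unfold max_abs. apply (iota_unique (V := R_CompleteNormedModule)).
    - intros M [[s0 [Hs0 E0]] HM]. apply Rle_antisym.
      + rewrite <- E0. specialize (Hm1 s0 Hs0). now rewrite !clamp_id in Hm1 by lra.
      + now apply HM.
    - split; [now exists m|]. intros s0 Hs0. specialize (Hm1 s0 Hs0).
      now rewrite !clamp_id in Hm1 by lra. }
  rewrite E. specialize (Hm1 s Hs). now rewrite !clamp_id in Hm1 by lra.
Qed.

(** * Power decay *)

(** Telescoping: by the mean value theorem,
    [alpha (k + 1)^(- 1 - alpha) <= k^(- alpha) - (k + 1)^(- alpha)]. *)
Lemma ex_series_Rpower (alpha : R) : 0 < alpha ->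
  ex_series (fun k => Rpower (INR (S k)) (- (1 + alpha))).
Proof.
  intros Ha.
  set (P := fun k => Rpower (INR (S k)) (- (1 + alpha))).
  set (q := fun k => Rpower (INR (S k)) (- alpha)).
  assert (Hstep : forall k, alpha * P (S k) <= q k - q (S k)).
  { intros k. pose proof (lt_0_INR (S k) ltac:(lia)) as Hk.
    destruct (MVT_gen (fun x => Rpower x (- alpha)) (INR (S k)) (INR (S (S k)))
      (fun x => - alpha * Rpower x (- alpha - 1))) as [c [Hc E]].
    - intros x Hx. rewrite Rmin_left in Hx by (rewrite (S_INR (S k)); lra).
      apply is_derive_Reals. apply derivable_pt_lim_power. lra.
    - intros x Hx. rewrite Rmin_left in Hx by (rewrite (S_INR (S k)); lra).
      apply derivable_continuous_pt. eexists. apply derivable_pt_lim_power. lra.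
    - rewrite Rmin_left, Rmax_right in Hc by (rewrite (S_INR (S k)); lra).
      unfold q. replace (INR (S (S k)) - INR (S k)) with 1 in E by (rewrite (S_INR (S k)); ring).
      assert (Hp : P (S k) <= Rpower c (- alpha - 1)).
      { unfold P, Rpower. apply exp_le_mono.
        assert (ln c <= ln (INR (S (S k)))) by (apply ln_le; lra). nra. }
      nra. }
  assert (Hsum : forall n, alpha * sum_n P n <= alpha * P O + q O - q n).
  { induction n as [|n IH]; [rewrite sum_O; lra|].
    rewrite sum_Sn. change (plus (sum_n P n) (P (S n))) with (sum_n P n + P (S n)).
    specialize (Hstep n). lra. }
  apply (ex_finite_lim_seq_incr (sum_n P) (P O + q O / alpha)).
  - intros n. rewrite sum_Sn. change (sum_n P n <= sum_n P n + P (S n)).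
    assert (0 < P (S n)) by apply exp_pos. lra.
  - intros n. specialize (Hsum n). assert (0 < q n) by apply exp_pos.
    apply Rmult_le_reg_l with alpha; auto.
    replace (alpha * (P O + q O / alpha)) with (alpha * P O + q O) by (field; lra). lra.
Qed.

(** Splits off an integer power, the form in which the growth of the kernels is known. *)
Lemma lim_zero_decay (X : nat -> R) (m : nat) (alpha e : R) :
  e = INR m + (1 + alpha) -> is_lim_seq (fun n => X n * Rpower (INR n) e) 0 ->
  eventually (fun n => (0 < n)%nat -> 0 <= X n ->
    INR n ^ m * X n <= Rpower (INR n) (- (1 + alpha))).
Proof.
  intros -> H. destruct (proj1 (filterlim_R _ _ _) H 1 Rlt_0_1) as [n0 Hn0].
  exists n0. intros n Hn Hpos HX. specialize (Hn0 n Hn). rewrite Rminus_0_r in Hn0.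
  pose proof (lt_0_INR n Hpos) as Hx.
  rewrite Rpower_plus, Rpower_pow in Hn0 by exact Hx.
  rewrite Rpower_Ropp. set (p := Rpower (INR n) (1 + alpha)) in *.
  assert (Hp : 0 < p) by apply exp_pos.
  pose proof (Rle_abs (X n * (INR n ^ m * p))).
  apply Rmult_le_reg_r with p; auto. rewrite Rinv_l by lra. nra.
Qed.

(** * Termwise differentiation on a rectangle *)

(** The majorant is asked for from some index on, because the decay of the coefficients is
    asymptotic. *)
Definition dominated_on (D : R -> R -> Prop) (e : nat -> R -> R -> R) : Prop :=
  exists (M : nat -> R) (n0 : nat), ex_series M /\
    forall n t x, (n0 <= n)%nat -> D t x -> Rabs (e n t x) <= M n.

(** The terms, the added function and the sum are given by the formulas [e] and [h] on [D] only:
    derivatives relative to a rectangle are unspecified outside it, so this is what can be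
    carried from one derivative to the next. *)
Definition expands (D : R -> R -> Prop) (u : nat -> R -> R -> R) (g v : R -> R -> R)
    (e : nat -> R -> R -> R) (h : R -> R -> R) : Prop :=
  forall t x, D t x ->
    (forall n, u n t x = e n t x) /\ g t x = h t x /\
    v t x = Series (fun n => e n t x) + h t x.

Lemma dominated_on_ex_series D e t x : dominated_on D e -> D t x ->
  ex_series (fun n => Rabs (e n t x)).
Proof.
  intros (M & n0 & HM & He) Hx. apply dominated_ex_series with M n0; auto.
Qed.

Lemma expands_converges D u g v e h :
  expands D u g v e h -> dominated_on D e ->
  converges_abs_unif D u (fun t x => v t x - g t x).
Proof.
  intros Hex Hdom. split.
  - intros t x Hx. destruct (Hex t x Hx) as [Hu _].
    apply ex_series_ext with (fun n => Rabs (e n t x)).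
    + intros n. now rewrite Hu.
    + now apply dominated_on_ex_series with D.
  - destruct Hdom as (M & n0 & HM & He). intros eps Heps.
    destruct (dominated_tail M n0 HM eps Heps) as [N HN]. exists N. intros n Hn t x Hx.
    destruct (Hex t x Hx) as (Hu & Hg & Hv). rewrite Hg, Hv.
    rewrite (sum_n_ext _ (fun k => e k t x)) by (intros k; apply Hu).
    replace (Series (fun k => e k t x) + h t x - h t x) with (Series (fun k => e k t x)) by ring.
    apply (HN n Hn (fun k => e k t x)). auto.
Qed.

Lemma expands_continuous D u g v e h :
  expands D u g v e h -> dominated_on D e ->
  (forall n, continuous2_on D (e n)) -> continuous2_on D h -> continuous2_on D v.
Proof.
  intros Hex (M & n0 & HM & He) Hc Hh.
  apply continuous2_on_ext with (fun t x => Series (fun n => e n t x) + h t x).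
  { intros t x Hx. symmetry. apply (Hex t x Hx). }
  apply continuous2_on_plus; auto. intros p Hp.
  apply (filterlim_Series (within (fun p : R * R => D (fst p) (snd p)) (locally p))
    (fun n p => e n (fst p) (snd p)) (fun n => e n (fst p) (snd p)) M n0); auto.
  - intros n. apply (Hc n p Hp).
  - unfold within. apply filter_forall. intros q Hq n Hn. now apply He.
Qed.

Section Termwise.
Variables (a b c d : R).
Hypotheses (Hab : a < b) (Hcd : c < d).
Let Q := rect a b c d.
Variables (u : nat -> R -> R -> R) (g v : R -> R -> R).
Variables (e e' : nat -> R -> R -> R) (h h' : R -> R -> R).
Hypotheses (Hex : expands Q u g v e h) (Hdom : dominated_on Q e) (Hdom' : dominated_on Q e').

(** The conclusion has the shape of the hypothesis, with [e'] and [h'] for [e] and [h], so that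
    the lemma and its companion for [t] can be iterated. *)
Lemma termwise_x :
  (forall n t x, Q t x -> is_derive_in c d (fun y => e n t y) x (e' n t x)) ->
  (forall t x, Q t x -> is_derive_in c d (fun y => h t y) x (h' t x)) ->
  termwise (ex_partial_x c d) (partial_x c d) Q u g v /\
  expands Q (fun n => partial_x c d (u n)) (partial_x c d g) (partial_x c d v) e' h'.
Proof.
  intros He Hh.
  assert (Hu : forall n t x, Q t x -> is_derive_in c d (fun y => u n t y) x (e' n t x)).
  { intros n t x Hx. apply is_derive_in_ext with (fun y => e n t y); [apply Hx| |now apply He].
    intros y Hy. symmetry. apply Hex. split; [apply Hx | exact Hy]. }
  assert (Hg : forall t x, Q t x -> is_derive_in c d (fun y => g t y) x (h' t x)).
  { intros t x Hx. apply is_derive_in_ext with (fun y => h t y); [apply Hx| |now apply Hh].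
    intros y Hy. symmetry. apply Hex. split; [apply Hx | exact Hy]. }
  assert (Hv : forall t x, Q t x -> is_derive_in c d (fun y => v t y) x
    (Series (fun n => e' n t x) + h' t x)).
  { intros t x Hx.
    apply is_derive_in_ext with (fun y => Series (fun n => e n t y) + h t y); [apply Hx| |].
    - intros y Hy. symmetry. apply Hex. split; [apply Hx | exact Hy].
    - apply is_derive_in_plus; [|now apply Hh].
      destruct Hdom' as (M & n0 & HM & HB).
      apply (is_derive_in_Series c d (fun n y => e n t y) (fun n y => e' n t y) M n0 x); auto.
      + apply Hx.
      + intros n y Hy. apply He. split; [apply Hx | exact Hy].
      + intros n y Hn Hy. apply HB; auto. split; [apply Hx | exact Hy].
      + intros y Hy. apply ex_series_Rabs. apply dominated_on_ex_series with Q; auto.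
        split; [apply Hx | exact Hy]. }
  assert (Hexp : expands Q (fun n => partial_x c d (u n)) (partial_x c d g)
     (partial_x c d v) e' h').
  { intros t x Hx. repeat split; try intros n; unfold partial_x;
      apply Derive_in_unique; auto; apply Hx. }
  split; auto. split; [|now apply expands_converges with e' h'].
  intros t x Hx. repeat split; try intros n; eexists; eauto.
Qed.

Lemma termwise_t :
  (forall n t x, Q t x -> is_derive_in a b (fun s => e n s x) t (e' n t x)) ->
  (forall t x, Q t x -> is_derive_in a b (fun s => h s x) t (h' t x)) ->
  termwise (ex_partial_t a b) (partial_t a b) Q u g v /\
  expands Q (fun n => partial_t a b (u n)) (partial_t a b g) (partial_t a b v) e' h'.
Proof.
  intros He Hh.
  assert (Hu : forall n t x, Q t x -> is_derive_in a b (fun s => u n s x) t (e' n t x)).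
  { intros n t x Hx. apply is_derive_in_ext with (fun s => e n s x); [apply Hx| |now apply He].
    intros s Hs. symmetry. apply Hex. split; [exact Hs | apply Hx]. }
  assert (Hg : forall t x, Q t x -> is_derive_in a b (fun s => g s x) t (h' t x)).
  { intros t x Hx. apply is_derive_in_ext with (fun s => h s x); [apply Hx| |now apply Hh].
    intros s Hs. symmetry. apply Hex. split; [exact Hs | apply Hx]. }
  assert (Hv : forall t x, Q t x -> is_derive_in a b (fun s => v s x) t
    (Series (fun n => e' n t x) + h' t x)).
  { intros t x Hx.
    apply is_derive_in_ext with (fun s => Series (fun n => e n s x) + h s x); [apply Hx| |].
    - intros s Hs. symmetry. apply Hex. split; [exact Hs | apply Hx].
    - apply is_derive_in_plus; [|now apply Hh].
      destruct Hdom' as (M & n0 & HM & HB).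
      apply (is_derive_in_Series a b (fun n s => e n s x) (fun n s => e' n s x) M n0 t); auto.
      + apply Hx.
      + intros n s Hs. apply He. split; [exact Hs | apply Hx].
      + intros n s Hn Hs. apply HB; auto. split; [exact Hs | apply Hx].
      + intros s Hs. apply ex_series_Rabs. apply dominated_on_ex_series with Q; auto.
        split; [exact Hs | apply Hx]. }
  assert (Hexp : expands Q (fun n => partial_t a b (u n)) (partial_t a b g)
     (partial_t a b v) e' h').
  { intros t x Hx. repeat split; try intros n; unfold partial_t;
      apply Derive_in_unique; auto; apply Hx. }
  split; auto. split; [|now apply expands_converges with e' h'].
  intros t x Hx. repeat split; try intros n; eexists; eauto.
Qed.

End Termwise.

Lemma termwise_subset ex op (D D' : R -> R -> Prop) u g v :
  (forall t x, D' t x -> D t x) -> termwise ex op D u g v -> termwise ex op D' u g v.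
Proof.
  intros HD (H1 & H2 & H3). split; [|split]; auto.
  intros eps Heps. destruct (H3 eps Heps) as [n0 Hn0]. exists n0. auto.
Qed.

(** * Decay of the amplitudes *)

(** A derivative of the amplitude is bounded through the same derivative of the kernel, so one bound
    [C] serves for all three orders when each is weighted with its power of [x]. *)
Lemma ampl_bounds (tau a b T : R) (N : nat) (Phi F : R -> R) (Phi1 x Z h t : R) :
  0 < tau -> 0 < T ->
  continuous_on (fun t => - tau <= t <= 0) Phi -> continuous_on (fun t => 0 <= t <= T) F ->
  1 <= x ->
  (forall t, 0 <= t <= T -> x ^ 2 * Rabs (sinK tau a b N t) <= Z /\
    x * Rabs (cosK tau a b N t) <= Z /\ Rabs (dcosK tau a b N t) <= Z) ->
  (forall t, 0 <= t <= T -> Rabs (forcing tau a b T Phi F t) <= h) ->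
  0 <= t <= T ->
  let C := x ^ 2 * Rabs (Phi 0) + Z * Rabs Phi1 + h + T * (Z * h) in
  x ^ 2 * Rabs (ampl tau a b T N Phi F Phi1 t) <= C /\
  x * Rabs (ampl1 tau a b T N Phi F Phi1 t) <= C /\
  Rabs (ampl2 tau a b T N Phi F Phi1 t) <= C.
Proof.
  intros Htau HT HPhi HF Hx HK Hh Ht C.
  pose proof (continuous_forcing tau a b T Htau HT Phi F HPhi HF) as Hfc.
  assert (Hx2 : 0 < x ^ 2) by (apply pow_lt; lra).
  assert (Hh0 : 0 <= h) by (apply Rle_trans with (2 := Hh t Ht); apply Rabs_pos).
  assert (HZ0 : 0 <= Z) by (apply Rle_trans with (2 := proj2 (proj2 (HK t Ht))); apply Rabs_pos).
  assert (HZh : 0 <= Z * h) by now apply Rmult_le_pos.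
  assert (H0 : 0 <= x ^ 2 * Rabs (Phi 0)) by (apply Rmult_le_pos; [lra | apply Rabs_pos]).
  assert (Hconv : forall k y, 0 < y -> (forall s, continuous k s) ->
    (forall s, 0 <= s <= T -> y * Rabs (k s) <= Z) ->
    y * Rabs (Phi1 * k t) <= Z * Rabs Phi1 /\
    y * Rabs (conv k (forcing tau a b T Phi F) t) <= T * (Z * h)).
  { intros k y Hy Hk HkZ. split.
    - rewrite Rabs_mult. pose proof (HkZ t Ht). pose proof (Rabs_pos Phi1). nra.
    - assert (Hb : Rabs (conv k (forcing tau a b T Phi F) t) <= T * (Z / y * h)).
      { apply conv_bound; auto. intros s Hs. apply Rle_div_r; [exact Hy|].
        rewrite Rmult_comm. now apply HkZ. }
      apply (Rmult_le_compat_l y) in Hb; [|lra].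
      replace (y * (T * (Z / y * h))) with (T * (Z * h)) in Hb by (field; lra). exact Hb. }
  destruct (Hconv (sinK tau a b N) (x ^ 2) Hx2 (continuous_sinK tau a b N)
    (fun s Hs => proj1 (HK s Hs))) as [S1 S2].
  destruct (Hconv (cosK tau a b N) x ltac:(lra) (continuous_cosK tau a b N)
    (fun s Hs => proj1 (proj2 (HK s Hs)))) as [C1 C2].
  destruct (Hconv (dcosK tau a b N) 1 Rlt_0_1 (continuous_dcosK tau a b N)
    ltac:(intros s Hs; rewrite Rmult_1_l; apply HK, Hs)) as [D1 D2].
  rewrite Rmult_1_l in D1, D2.
  assert (H1 : 0 <= Z * Rabs Phi1) by (apply Rmult_le_pos; [auto | apply Rabs_pos]).
  unfold C. repeat split.
  - unfold ampl.
    eapply Rle_trans; [apply Rmult_le_compat_l; [lra | apply Rabs_triang]|].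
    pose proof (Rabs_triang (Phi 0) (Phi1 * sinK tau a b N t)). nra.
  - unfold ampl1.
    eapply Rle_trans; [apply Rmult_le_compat_l; [lra | apply Rabs_triang]|]. lra.
  - unfold ampl2. eapply Rle_trans; [apply Rabs_triang|].
    pose proof (Rabs_triang (Phi1 * dcosK tau a b N t) (forcing tau a b T Phi F t)).
    pose proof (Hh t Ht). lra.
Qed.

(** Here [p] is the summable rate. Two of the powers of [x] in the bounds on [Phi] absorb the
    coefficients [a] and [b] of the forcing, and [N] of them the growth of the kernels. *)
Lemma ampl_decay (tau a b T A B : R) (N : nat) (Phi F : R -> R) (Phi1 x p t : R) :
  0 < tau -> 0 < T -> 0 <= A -> 0 <= B ->
  continuous_on (fun t => - tau <= t <= 0) Phi -> continuous_on (fun t => 0 <= t <= T) F ->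
  1 <= x -> Rabs a <= B * x ^ 2 -> Rabs b <= B * x ^ 2 ->
  (forall t, 0 <= t <= T -> x ^ 2 * Rabs (sinK tau a b N t) <= A * x ^ N /\
    x * Rabs (cosK tau a b N t) <= A * x ^ N /\ Rabs (dcosK tau a b N t) <= A * x ^ N) ->
  x ^ (N + 2) * (Rabs (Phi 0) + Rabs Phi1) <= p ->
  x ^ (N + 3) * max_abs (- tau) 0 Phi <= p ->
  x ^ (N + 1) * max_abs 0 T F <= p ->
  0 <= t <= T ->
  let C := 1 + A + (1 + T * A) * (2 * B + 1) in
  x ^ 2 * Rabs (ampl tau a b T N Phi F Phi1 t) <= C * p /\
  x * Rabs (ampl1 tau a b T N Phi F Phi1 t) <= C * p /\
  Rabs (ampl2 tau a b T N Phi F Phi1 t) <= C * p.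
Proof.
  intros Htau HT HA HB HPhi HF Hx Ha Hb HK H0 HmP HmF Ht C.
  set (mP := max_abs (- tau) 0 Phi) in *. set (mF := max_abs 0 T F) in *.
  assert (HP0 : 0 <= mP).
  { apply Rle_trans with (Rabs (Phi 0)); [apply Rabs_pos|]. apply le_max_abs; auto; lra. }
  assert (HF0 : 0 <= mF).
  { apply Rle_trans with (Rabs (F 0)); [apply Rabs_pos|]. apply le_max_abs; auto; lra. }
  set (h := B * x ^ 2 * Rabs (Phi 0) + B * x ^ 2 * mP + mF).
  assert (Hforc : forall s, 0 <= s <= T -> Rabs (forcing tau a b T Phi F s) <= h).
  { intros s Hs. unfold forcing, h.
    pose proof (le_max_abs _ _ Phi _ (clamp_in (- tau) 0 (s - tau) ltac:(lra)) HPhi) as M1.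
    pose proof (le_max_abs _ _ F _ (clamp_in 0 T s ltac:(lra)) HF) as M2.
    fold mP in M1. fold mF in M2.
    eapply Rle_trans; [apply Rabs_triang|]. apply Rplus_le_compat; auto.
    eapply Rle_trans; [apply Rabs_triang|]. rewrite !Rabs_mult.
    apply Rplus_le_compat.
    - apply Rmult_le_compat_r; [apply Rabs_pos | exact Ha].
    - apply Rmult_le_compat; auto; apply Rabs_pos. }
  destruct (ampl_bounds tau a b T N Phi F Phi1 x (A * x ^ N) h t) as (B1 & B2 & B3); auto.
  set (P0 := Rabs (Phi 0)) in *. set (P1 := Rabs Phi1) in *.
  assert (0 <= P0) by apply Rabs_pos. assert (0 <= P1) by apply Rabs_pos.
  set (y := x ^ N) in *. assert (Hy : 1 <= y) by now apply pow_R1_Rle.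
  rewrite !pow_add in H0, HmP, HmF. fold y in H0, HmP, HmF.
  set (z := x ^ 2) in *. assert (Hz : 1 <= z) by now apply pow_R1_Rle.
  assert (Hx3 : z <= x ^ 3) by (apply Rle_pow; [exact Hx | lia]).
  rewrite pow_1 in HmF.
  assert (Hyz : 0 <= y * z) by nra.
  assert (Q0 : y * z * P0 <= p) by nra.
  assert (Q1 : y * z * P1 <= p) by nra.
  assert (QP : y * z * mP <= p).
  { apply Rle_trans with (2 := HmP). apply Rmult_le_compat_r; auto.
    apply Rmult_le_compat_l; lra. }
  assert (QF : y * mF <= p).
  { apply Rle_trans with (2 := HmF). apply Rmult_le_compat_r; nra. }
  assert (Hyh : y * h <= (2 * B + 1) * p).
  { replace (y * h) with (B * (y * z * P0) + B * (y * z * mP) + y * mF) by (unfold h; ring).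
    assert (B * (y * z * P0) <= B * p) by now apply Rmult_le_compat_l.
    assert (B * (y * z * mP) <= B * p) by now apply Rmult_le_compat_l. lra. }
  assert (Hh0 : 0 <= h) by (apply Rle_trans with (2 := Hforc t Ht); apply Rabs_pos).
  assert (Hhh : h <= y * h) by nra.
  assert (E0 : z * P0 <= p).
  { apply Rle_trans with (2 := Q0). assert (0 <= z * P0) by nra. nra. }
  assert (E1 : A * y * P1 <= A * p).
  { rewrite Rmult_assoc. apply Rmult_le_compat_l; auto.
    apply Rle_trans with (2 := Q1). assert (0 <= y * P1) by nra. nra. }
  assert (E2 : T * (A * y * h) <= T * A * ((2 * B + 1) * p)).
  { replace (T * (A * y * h)) with (T * A * (y * h)) by ring.
    apply Rmult_le_compat_l; auto. apply Rmult_le_pos; lra. }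
  assert (HC : z * P0 + A * y * P1 + h + T * (A * y * h) <= C * p).
  { unfold C. replace ((1 + A + (1 + T * A) * (2 * B + 1)) * p)
      with (p + A * p + (2 * B + 1) * p + T * A * ((2 * B + 1) * p)) by ring. lra. }
  repeat split; eapply Rle_trans; eauto.
Qed.

(** * The boundary lift, the symbols and the theorem *)

Lemma is_derive_in_lift (a b L t m1 m2 x : R) (g1 g2 : R -> R) :
  is_derive_in a b g1 t m1 -> is_derive_in a b g2 t m2 ->
  is_derive_in a b (fun s => boundary_lift L g1 g2 s x) t (m1 + x / L * (m2 - m1)).
Proof.
  intros H1 H2. unfold boundary_lift.
  apply (is_derive_in_plus a b g1 (fun s => x / L * (g2 s - g1 s))); auto.
  apply is_derive_in_scal. replace (m2 - m1) with (m2 + -1 * m1) by ring.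
  unfold is_derive_in.
  apply filterlim_ext with (fun s => (g2 s + -1 * g1 s - (g2 t + -1 * g1 t)) / (s - t)).
  { refine (fun s : R => _). match goal with |- @eq _ ?u ?v => change (@eq R u v) end.
    f_equal. ring. }
  change (is_derive_in a b (fun s => g2 s + -1 * g1 s) t (m2 + -1 * m1)).
  apply is_derive_in_plus; auto. now apply is_derive_in_scal.
Qed.

(** The lift is affine in [x] with coefficients that are linear in the data, so its time derivatives
    are again boundary lifts. *)
Lemma C2_on_lift (a b L : R) (g1 g2 : R -> R) : a < b -> C2_on a b g1 -> C2_on a b g2 ->
  forall t x, a <= t <= b ->
  let d1 := Derive_in a b g1 in let d2 := Derive_in a b g2 in
  is_derive_in a b (fun s => boundary_lift L g1 g2 s x) t (boundary_lift L d1 d2 t x) /\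
  is_derive_in a b (fun s => boundary_lift L d1 d2 s x) t
    (boundary_lift L (Derive_in a b d1) (Derive_in a b d2) t x).
Proof.
  intros Hab (E1 & E1' & _) (E2 & E2' & _) t x Ht d1 d2. split.
  - apply is_derive_in_lift; apply Derive_in_correct; auto.
  - apply is_derive_in_lift; apply Derive_in_correct; auto.
Qed.

Lemma eventually_INR_ge (x : R) : eventually (fun n => x <= INR n).
Proof.
  destruct (nfloor_ex (Rmax 0 x) (Rmax_l 0 x)) as [n Hn].
  exists (S n). intros m Hm. apply le_INR in Hm. rewrite S_INR in Hm.
  pose proof (Rmax_r 0 x). lra.
Qed.

(** From [n >= 2 |d| / c] on, the constant [d] is at most half of the leading term. *)
Lemma symbol_bounds (c d : R) : 0 < c -> eventually (fun n =>
  c / 2 * INR n ^ 2 <= c * INR n ^ 2 - d /\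
  Rabs (c * INR n ^ 2 - d) <= (c + Rabs d) * INR n ^ 2).
Proof.
  intros Hc. destruct (eventually_INR_ge (Rmax 1 (2 * Rabs d / c))) as [n0 Hn0].
  exists n0. intros n Hn. specialize (Hn0 n Hn).
  pose proof (Rmax_l 1 (2 * Rabs d / c)). pose proof (Rmax_r 1 (2 * Rabs d / c)) as H2.
  set (x := INR n) in *. assert (Hx : 1 <= x) by lra.
  assert (Hd : Rabs d <= c / 2 * x).
  { apply Rle_trans with (c / 2 * (2 * Rabs d / c)); [right; field; lra|].
    apply Rmult_le_compat_l; lra. }
  pose proof (Rle_abs d). pose proof (Rabs_pos d).
  assert (Hxx : x <= x ^ 2) by nra.
  assert (c / 2 * x <= c / 2 * x ^ 2) by (apply Rmult_le_compat_l; lra).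
  split; [lra|].
  eapply Rle_trans; [apply Rabs_triang|]. rewrite Rabs_Ropp, Rabs_pos_eq by nra.
  assert (Rabs d * 1 <= Rabs d * x ^ 2) by (apply Rmult_le_compat_l; lra). lra.
Qed.

Lemma is_derive_lift_x (L t x : R) (g1 g2 : R -> R) : L <> 0 ->
  is_derive (fun y => boundary_lift L g1 g2 t y) x ((g2 t - g1 t) / L).
Proof. intros HL. unfold boundary_lift. auto_derive; auto. field. auto. Qed.

Lemma continuous_on_continuous (I : R -> Prop) (g : R -> R) :
  (forall x, continuous g x) -> continuous_on I g.
Proof.
  intros Hg x _ P HP. specialize (Hg x P HP). unfold filtermap, within in *.
  revert Hg. apply filter_imp. auto.
Qed.

Theorem theorem5 (T tau : R) (N : nat) (L a1 a2 d1 d2 : R)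
  (mu1 mu2 : R -> R) (phi f : R -> R -> R) (alpha : R)
  (hT : 0 < T) (htau : 0 < tau) (hTN : T = INR N * tau) (hL : 0 < L)
  (ha1 : a1 <> 0) (ha2 : a2 <> 0)
  (hmu1 : C2_on (- tau) T mu1) (hmu2 : C2_on (- tau) T mu2)
  (hf : continuous2_on (rect 0 T 0 L) f)
  (hphi : continuous2_on (rect (- tau) 0 0 L) phi)
  (hphi_t : forall t x, rect (- tau) 0 0 L t x -> ex_partial_t (- tau) 0 phi t x)
  (hphi_tc : continuous2_on (rect (- tau) 0 0 L) (partial_t (- tau) 0 phi))
  (hphi0 : forall t, - tau <= t <= 0 -> phi t 0 = mu1 t)
  (hphiL : forall t, - tau <= t <= 0 -> phi t L = mu2 t)
  (halpha : 0 < alpha) :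
  let K := Z.to_nat (Zceil (T / tau)) in
  let G := boundary_lift L mu1 mu2 in
  let Phi := fun t x => phi t x - G t x in
  let F := fun t x => f t x + d1 * G t x + d2 * G (t - tau) x
                      - partial_t (- tau) T (partial_t (- tau) T G) t x in
  let Phi_ := sine_coeff L Phi in
  let F_ := sine_coeff L F in
  let dPhi0 := fun n => Derive_in (- tau) 0 (Phi_ n) 0 in
  let omega2 := fun n => (INR n * PI * a1 / L) ^ 2 - d1 in
  let upsilon2 := fun n => (INR n * PI * a2 / L) ^ 2 - d2 in
  let Cn := fun n => delayC tau (- omega2 n) (- upsilon2 n) in
  let Sn := fun n => delayS tau (- omega2 n) (- upsilon2 n) in
  let mode := fun n t x =>
    (Cn n t * Phi_ n 0 + Sn n t * dPhi0 n
     - upsilon2 n * RInt (fun s => Sn n (t - tau - s) * Phi_ n s) (- tau) 0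
     + RInt (fun s => Sn n (t - s) * F_ n s) 0 t)
    * sin (INR n * PI / L * x) in
  (* [u k] is the term of index [k + 1] of the series, which starts at 1 *)
  let u := fun k => mode (S k) in
  let v := fun t x => Series (fun k => u k t x) + G t x in
  let Q := rect 0 T 0 L in
  let strip := fun (m : nat) t x =>
    (INR m - 1) * tau < t < INR m * tau /\ 0 <= x <= L in
  let dt := partial_t 0 T in
  let dx := partial_x 0 L in
  eventually (fun n => 0 < omega2 n /\ 0 < upsilon2 n) ->
  is_lim_seq (fun n => (Rabs (Phi_ n 0) + Rabs (dPhi0 n))
                       * Rpower (INR n) (INR K + 3 + alpha)) 0 ->
  is_lim_seq (fun n => max_abs (- tau) 0 (Phi_ n)
                       * Rpower (INR n) (INR K + 4 + alpha)) 0 ->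
  is_lim_seq (fun n => max_abs 0 T (F_ n)
                       * Rpower (INR n) (INR K + 2 + alpha)) 0 ->
  converges_abs_unif Q u (fun t x => v t x - G t x)
  /\ (continuous2_on Q v
      /\ continuous2_on Q (dx v)
      /\ continuous2_on Q (dx (dx v))
      /\ continuous2_on Q (dt v)
      /\ continuous2_on Q (dx (dt v)))
  /\ (termwise (ex_partial_x 0 L) dx Q u G v
      /\ termwise (ex_partial_x 0 L) dx Q (fun k => dx (u k)) (dx G) (dx v)
      /\ termwise (ex_partial_t 0 T) dt Q u G v
      /\ termwise (ex_partial_x 0 L) dx Q (fun k => dt (u k)) (dt G) (dt v))
  /\ (forall m : nat, (1 <= m <= K)%nat ->
      termwise (ex_partial_t 0 T) dt (strip m) (fun k => dt (u k)) (dt G) (dt v)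
      /\ continuous2_on (strip m) (dt (dt v))
      /\ (forall x, 0 <= x <= L ->
          (exists l : R, filterlim (fun t => dt (dt v) t x)
                           (at_left (INR m * tau)) (locally l))
          /\ ((m < K)%nat ->
              exists l : R, filterlim (fun t => dt (dt v) t x)
                              (at_right (INR m * tau)) (locally l)))).
Proof.
  intros K G Phi F Phi_ F_ dPhi0 omega2 upsilon2 Cn Sn mode u v Q strip dt dx
    _ Hlim0 HlimP HlimF.
  assert (HN : (1 <= N)%nat).
  { destruct N; [|lia]. simpl in hTN. lra. }
  assert (HK : K = N).
  { unfold K. replace (T / tau) with (INR N) by (rewrite hTN; field; lra).
    rewrite (Zceil_eq (Z.of_nat N)); [apply Nat2Z.id|]. rewrite <- INR_IZR_INZ. lra. }
  assert (HtT : - tau < T) by lra.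
  set (m1 := Derive_in (- tau) T mu1). set (m2 := Derive_in (- tau) T mu2).
  set (k1 := Derive_in (- tau) T m1). set (k2 := Derive_in (- tau) T m2).
  pose proof (C2_on_lift (- tau) T L mu1 mu2 HtT hmu1 hmu2) as HG.
  cbv zeta in HG. fold m1 m2 k1 k2 in HG. fold G in HG.
  destruct hmu1 as (_ & _ & Cmu1 & Cm1 & Ck1). destruct hmu2 as (_ & _ & Cmu2 & Cm2 & Ck2).
  fold m1 in Cm1. fold m1 k1 in Ck1. fold m2 in Cm2. fold m2 k2 in Ck2.
  assert (HGt : forall t x, - tau <= t <= T ->
    partial_t (- tau) T G t x = boundary_lift L m1 m2 t x).
  { intros t x Ht. apply Derive_in_unique; auto. exact (proj1 (HG t x Ht)). }
  assert (HGtt : forall t x, - tau <= t <= T ->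
    partial_t (- tau) T (partial_t (- tau) T G) t x = boundary_lift L k1 k2 t x).
  { intros t x Ht. apply Derive_in_unique; auto.
    apply is_derive_in_ext with (fun s => boundary_lift L m1 m2 s x); auto.
    - intros s Hs. now rewrite HGt.
    - exact (proj2 (HG t x Ht)). }
  assert (CG : forall a b c d, - tau <= a -> b <= T -> continuous2_on (rect a b c d) G).
  { intros a b c d Ha Hb. apply continuous2_on_subset with (rect (- tau) T c d).
    - intros t x [H1 H2]. split; [lra | exact H2].
    - now apply continuous2_on_lift. }
  assert (CPhi : forall n, continuous_on (fun t => - tau <= t <= 0) (Phi_ n)).
  { intros n. apply continuous_sine_coeff; [lra | exact hL|].
    apply continuous2_on_ext with (fun t x => phi t x + -1 * G t x).
    - intros t x _. unfold Phi. ring.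
    - apply continuous2_on_plus; auto. apply continuous2_on_mult.
      + apply continuous2_on_const.
      + apply CG; lra. }
  assert (CF : forall n, continuous_on (fun t => 0 <= t <= T) (F_ n)).
  { intros n. apply continuous_sine_coeff; [lra | exact hL|].
    apply continuous2_on_ext with (fun t x => f t x + d1 * G t x
      + d2 * boundary_lift L (fun t => mu1 (t - tau)) (fun t => mu2 (t - tau)) t x
      + -1 * boundary_lift L k1 k2 t x).
    - intros t x [Ht Hx]. unfold F. rewrite HGtt by lra. unfold G, boundary_lift. ring.
    - assert (Hsh : forall t, 0 <= t <= T -> - tau <= t - tau <= T) by (intros; lra).
      repeat apply continuous2_on_plus; auto.
      + apply continuous2_on_mult; [apply continuous2_on_const | apply CG; lra].
      + apply continuous2_on_mult; [apply continuous2_on_const|].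
        apply continuous2_on_lift; now apply (continuous_on_shift (- tau) T).
      + apply continuous2_on_mult; [apply continuous2_on_const|].
        apply continuous2_on_subset with (rect (- tau) T 0 L).
        * intros t x [H1 H2]. split; [lra | exact H2].
        * now apply continuous2_on_lift. }
  assert (HTN : T <= (INR N + 1) * tau) by (rewrite hTN; lra).
  set (lam := fun n => INR n * PI / L).
  set (y := fun n => ampl tau (- omega2 n) (- upsilon2 n) T N (Phi_ n) (F_ n) (dPhi0 n)).
  set (y1 := fun n => ampl1 tau (- omega2 n) (- upsilon2 n) T N (Phi_ n) (F_ n) (dPhi0 n)).
  set (y2 := fun n => ampl2 tau (- omega2 n) (- upsilon2 n) T N (Phi_ n) (F_ n) (dPhi0 n)).
  assert (Dy : forall n t, is_derive (y n) t (y1 n t)).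
  { intros n t. now apply is_derive_ampl. }
  assert (Dy1 : forall n t, is_derive (y1 n) t (y2 n t)).
  { intros n t. now apply is_derive_ampl1. }
  assert (Cy2 : forall n t, continuous (y2 n) t).
  { intros n t. now apply continuous_ampl2. }
  assert (Cy : forall n t, continuous (y n) t).
  { intros n t. apply (ex_derive_continuous (V := R_NormedModule)). eexists. apply Dy. }
  assert (Cy1 : forall n t, continuous (y1 n) t).
  { intros n t. apply (ex_derive_continuous (V := R_NormedModule)). eexists. apply Dy1. }
  assert (Hmode : forall n t x, Q t x -> mode n t x = y n t * sin (lam n * x)).
  { intros n t x [Ht Hx]. unfold mode, Cn, Sn, lam, y. f_equal.
    rewrite <- (ampl_eq tau (- omega2 n) (- upsilon2 n) T N htau hT HTN (Phi_ n) (F_ n)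
      (dPhi0 n) (CPhi n) (CF n) t Ht). ring. }
  (* all weighted amplitudes are bounded by the summable rate [n^(- 1 - alpha)] *)
  set (p := fun n => Rpower (INR n) (- (1 + alpha))).
  assert (Hdecay : exists C n0, forall n t, (n0 <= n)%nat -> 0 <= t <= T ->
    INR n ^ 2 * Rabs (y n t) <= C * p n /\ INR n * Rabs (y1 n t) <= C * p n /\
    Rabs (y2 n t) <= C * p n).
  { set (c1 := (PI * a1 / L) ^ 2). set (c2 := (PI * a2 / L) ^ 2).
    assert (Hc : forall a, a <> 0 -> 0 < (PI * a / L) ^ 2).
    { intros a Ha. apply pow2_gt_0. pose proof PI_neq0.
      apply Rmult_integral_contrapositive; split; [|apply Rinv_neq_0_compat; lra].
      now apply Rmult_integral_contrapositive. }
    pose proof (Hc a1 ha1) as Hc1. pose proof (Hc a2 ha2) as Hc2. fold c1 in Hc1. fold c2 in Hc2.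
    assert (Eo : forall n, omega2 n = c1 * INR n ^ 2 - d1).
    { intros n. unfold omega2, c1. field. lra. }
    assert (Eu : forall n, upsilon2 n = c2 * INR n ^ 2 - d2).
    { intros n. unfold upsilon2, c2. field. lra. }
    set (B := c1 + Rabs d1 + (c2 + Rabs d2)).
    pose proof (Rabs_pos d1) as Hd1. pose proof (Rabs_pos d2) as Hd2.
    assert (HB : 0 <= B) by (unfold B; lra).
    destruct (kernel_growth tau (c1 / 2) B N htau ltac:(lra) HB HN) as [A [HA HAK]].
    exists (1 + A + (1 + T * A) * (2 * B + 1)).
    rewrite HK in Hlim0, HlimP, HlimF.
    pose proof (lim_zero_decay (fun n => Rabs (Phi_ n 0) + Rabs (dPhi0 n)) (N + 2)
      alpha (INR N + 3 + alpha) ltac:(rewrite plus_INR; simpl; ring) Hlim0) as L0.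
    pose proof (lim_zero_decay (fun n => max_abs (- tau) 0 (Phi_ n)) (N + 3)
      alpha (INR N + 4 + alpha) ltac:(rewrite plus_INR; simpl; ring) HlimP) as LP.
    pose proof (lim_zero_decay (fun n => max_abs 0 T (F_ n)) (N + 1)
      alpha (INR N + 2 + alpha) ltac:(rewrite plus_INR; simpl; ring) HlimF) as LF.
    pose proof (filter_and _ _ (symbol_bounds c1 d1 Hc1) (symbol_bounds c2 d2 Hc2)) as LS.
    pose proof (filter_and _ _ L0 (filter_and _ _ LP (filter_and _ _ LF
      (filter_and _ _ LS (eventually_INR_ge 1))))) as [n0 Hn0].
    exists n0. intros n t Hn Ht.
    destruct (Hn0 n Hn) as (E0 & EP & EF & [[S1 S2] [S3 S4]] & Hx).
    rewrite <- Eo in S1, S2. rewrite <- Eu in S3, S4.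
    assert (Hn1 : (0 < n)%nat) by (apply INR_lt; simpl; lra).
    assert (Hx2 : 0 <= INR n ^ 2) by apply pow2_ge_0.
    apply ampl_decay; auto.
    - rewrite Rabs_Ropp. eapply Rle_trans; [exact S2|].
      apply Rmult_le_compat_r; auto. unfold B; lra.
    - rewrite Rabs_Ropp. eapply Rle_trans; [exact S4|].
      apply Rmult_le_compat_r; auto. unfold B; lra.
    - intros s Hs. apply HAK; auto.
      + split; [exact S1|]. eapply Rle_trans; [apply Rle_abs|].
        eapply Rle_trans; [exact S2|]. apply Rmult_le_compat_r; auto. unfold B; lra.
      + rewrite Rabs_Ropp. eapply Rle_trans; [exact S4|].
        apply Rmult_le_compat_r; auto. unfold B; lra.
      + now rewrite <- hTN.
    - apply E0; auto. pose proof (Rabs_pos (Phi_ n 0)). pose proof (Rabs_pos (dPhi0 n)). lra.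
    - apply EP; auto. apply Rle_trans with (Rabs (Phi_ n 0)); [apply Rabs_pos|].
      apply le_max_abs; auto; lra.
    - apply EF; auto. apply Rle_trans with (Rabs (F_ n 0)); [apply Rabs_pos|].
      apply le_max_abs; auto; lra. }
  destruct Hdecay as (C & n0 & Hdecay).
  pose proof PI_RGT_0 as Hpi. set (c := PI / L).
  assert (Hc : 0 < c) by (unfold c; now apply Rdiv_lt_0_compat).
  assert (Hlam : forall n, lam n = INR n * c) by (intros n; unfold lam, c; field; lra).
  set (size := fun n t => INR n ^ 2 * Rabs (y n t) + INR n * Rabs (y1 n t) + Rabs (y2 n t)).
  assert (Hdom : forall (e : nat -> R -> R -> R) W, 0 <= W ->
    (forall k t x, Q t x -> Rabs (e k t x) <= W * size (S k) t) -> dominated_on Q e).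
  { intros e W HW He. exists (fun k => scal (W * (3 * C)) (p (S k))), n0. split.
    - apply (ex_series_scal (V := R_NormedModule)). now apply ex_series_Rpower.
    - intros n t x Hn Hx. eapply Rle_trans; [now apply He|].
      change (scal (W * (3 * C)) (p (S n))) with (W * (3 * C) * p (S n)).
      rewrite Rmult_assoc. apply Rmult_le_compat_l; auto.
      destruct (Hdecay (S n) t ltac:(lia) (proj1 Hx)) as (H0 & H1 & H2).
      unfold size. lra. }
  assert (Hsize : forall k t, let n := INR (S k) in
    (n ^ 2 * Rabs (y (S k) t) <= size (S k) t /\ n * Rabs (y (S k) t) <= size (S k) t /\
     Rabs (y (S k) t) <= size (S k) t) /\
    (n * Rabs (y1 (S k) t) <= size (S k) t /\ Rabs (y1 (S k) t) <= size (S k) t) /\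
    Rabs (y2 (S k) t) <= size (S k) t).
  { intros k t n. assert (Hn : 1 <= n) by (change 1 with (INR 1); apply le_INR; lia).
    unfold size. fold n. pose proof (Rabs_pos (y (S k) t)) as A0.
    pose proof (Rabs_pos (y1 (S k) t)) as A1. pose proof (Rabs_pos (y2 (S k) t)) as A2.
    set (z0 := Rabs (y (S k) t)) in *. set (z1 := Rabs (y1 (S k) t)) in *.
    assert (n <= n ^ 2) by nra.
    pose proof (Rmult_le_compat_r z0 1 n A0 Hn).
    pose proof (Rmult_le_compat_r z0 n (n ^ 2) A0 H).
    pose proof (Rmult_le_compat_r z1 1 n A1 Hn). lra. }
  assert (Habs : forall a s l, Rabs s <= 1 -> Rabs (a * (l * s)) <= Rabs l * Rabs a).
  { intros a s l Hs. rewrite !Rabs_mult. pose proof (Rabs_pos a). pose proof (Rabs_pos l).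
    assert (0 <= Rabs l * Rabs a) by now apply Rmult_le_pos. nra. }
  assert (Hsin : forall z, Rabs (sin z) <= 1) by (intros z; apply Rabs_le, SIN_bound).
  assert (Hcos : forall z, Rabs (cos z) <= 1) by (intros z; apply Rabs_le, COS_bound).
  (* the two digits count the derivatives in [t] and in [x] *)
  set (e00 := fun k t x => y (S k) t * sin (lam (S k) * x)).
  set (e01 := fun k t x => y (S k) t * (lam (S k) * cos (lam (S k) * x))).
  set (e02 := fun k t x => y (S k) t * (- lam (S k) ^ 2 * sin (lam (S k) * x))).
  set (e10 := fun k t x => y1 (S k) t * sin (lam (S k) * x)).
  set (e11 := fun k t x => y1 (S k) t * (lam (S k) * cos (lam (S k) * x))).
  set (e20 := fun k t x => y2 (S k) t * sin (lam (S k) * x)).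
  assert (Habs1 : forall a s, Rabs s <= 1 -> Rabs (a * s) <= Rabs a).
  { intros a s Hs. rewrite Rabs_mult. pose proof (Rabs_pos a). nra. }
  assert (Hl : forall k, Rabs (lam (S k)) = INR (S k) * c).
  { intros k. rewrite Hlam. apply Rabs_pos_eq. pose proof (pos_INR (S k)). nra. }
  assert (D00 : dominated_on Q e00).
  { apply Hdom with 1; [lra|]. intros k t x _.
    pose proof (Hsize k t) as HS. cbv zeta in HS.
    eapply Rle_trans; [apply Habs1, Hsin|]. lra. }
  assert (D01 : dominated_on Q e01).
  { apply Hdom with c; [lra|]. intros k t x _.
    pose proof (Hsize k t) as HS. cbv zeta in HS.
    eapply Rle_trans; [apply Habs, Hcos|]. rewrite Hl, (Rmult_comm _ c), Rmult_assoc.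
    apply Rmult_le_compat_l; lra. }
  assert (D02 : dominated_on Q e02).
  { apply Hdom with (c ^ 2); [apply pow2_ge_0|]. intros k t x _.
    pose proof (Hsize k t) as HS. cbv zeta in HS.
    eapply Rle_trans; [apply Habs, Hsin|]. rewrite Rabs_Ropp, <- RPow_abs, Hl,
      Rpow_mult_distr, (Rmult_comm _ (c ^ 2)), Rmult_assoc.
    apply Rmult_le_compat_l; [apply pow2_ge_0 | lra]. }
  assert (D10 : dominated_on Q e10).
  { apply Hdom with 1; [lra|]. intros k t x _.
    pose proof (Hsize k t) as HS. cbv zeta in HS.
    eapply Rle_trans; [apply Habs1, Hsin|]. lra. }
  assert (D11 : dominated_on Q e11).
  { apply Hdom with c; [lra|]. intros k t x _.
    pose proof (Hsize k t) as HS. cbv zeta in HS.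
    eapply Rle_trans; [apply Habs, Hcos|]. rewrite Hl, (Rmult_comm _ c), Rmult_assoc.
    apply Rmult_le_compat_l; lra. }
  assert (D20 : dominated_on Q e20).
  { apply Hdom with 1; [lra|]. intros k t x _.
    pose proof (Hsize k t) as HS. cbv zeta in HS.
    eapply Rle_trans; [apply Habs1, Hsin|]. lra. }
  set (h01 := fun t (_ : R) => (mu2 t - mu1 t) / L).
  set (h02 := fun _ _ : R => 0).
  set (h10 := boundary_lift L m1 m2).
  set (h11 := fun t (_ : R) => (m2 t - m1 t) / L).
  set (h20 := boundary_lift L k1 k2).
  assert (HL0 : L <> 0) by lra.
  assert (X00 : expands Q u G v e00 G).
  { intros t x Hx. repeat split.
    - intros n. unfold u, e00. now apply Hmode.
    - unfold v. f_equal. apply Series_ext. intros n. unfold u, e00. now apply Hmode. }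
  destruct (termwise_x 0 T 0 L hL u G v e00 e01 G h01 X00 D00 D01) as [T01 X01].
  { intros n t x _. apply is_derive_is_derive_in. unfold e00, e01. auto_derive; auto. ring. }
  { intros t x _. now apply is_derive_is_derive_in, is_derive_lift_x. }
  destruct (termwise_x 0 T 0 L hL _ _ _ e01 e02 h01 h02 X01 D01 D02) as [T02 X02].
  { intros n t x _. apply is_derive_is_derive_in. unfold e01, e02. auto_derive; auto. ring. }
  { intros t x _. apply is_derive_is_derive_in. apply is_derive_Reals, derivable_pt_lim_const. }
  destruct (termwise_t 0 T 0 L hT u G v e00 e10 G h10 X00 D00 D10) as [T10 X10].
  { intros n t x _. apply is_derive_in_scal_r. apply is_derive_is_derive_in, Dy. }
  { intros t x [Ht _]. apply (is_derive_in_le 0 T (- tau) T); try lra.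
    exact (proj1 (HG t x ltac:(lra))). }
  destruct (termwise_x 0 T 0 L hL _ _ _ e10 e11 h10 h11 X10 D10 D11) as [T11 X11].
  { intros n t x _. apply is_derive_is_derive_in. unfold e10, e11. auto_derive; auto. ring. }
  { intros t x _. now apply is_derive_is_derive_in, is_derive_lift_x. }
  destruct (termwise_t 0 T 0 L hT _ _ _ e10 e20 h10 h20 X10 D10 D20) as [T20 X20].
  { intros n t x _. apply is_derive_in_scal_r. apply is_derive_is_derive_in, Dy1. }
  { intros t x [Ht _]. apply (is_derive_in_le 0 T (- tau) T); try lra.
    exact (proj2 (HG t x ltac:(lra))). }
  assert (Cprod : forall (g s : R -> R), (forall t, continuous g t) -> (forall x, continuous s x) ->
    continuous2_on Q (fun t x => g t * s x)).
  { intros g s Hg Hs. apply continuous2_on_mult; [|now apply continuous2_on_snd].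
    apply (continuous2_on_fst Q (fun _ => True)); auto. now apply continuous_on_continuous. }
  assert (Csin : forall l x, continuous (fun x => sin (l * x)) x).
  { intros l x. apply (ex_derive_continuous (V := R_NormedModule) (fun x => sin (l * x))).
    auto_derive; auto. }
  assert (Ccos : forall l x, continuous (fun x => l * cos (l * x)) x).
  { intros l x. apply (ex_derive_continuous (V := R_NormedModule) (fun x => l * cos (l * x))).
    auto_derive; auto. }
  assert (Csin2 : forall l x, continuous (fun x => - l ^ 2 * sin (l * x)) x).
  { intros l x. apply (ex_derive_continuous (V := R_NormedModule) (fun x => - l ^ 2 * sin (l * x))).
    auto_derive; auto. }
  assert (CQ : forall g, continuous_on (fun t => - tau <= t <= T) g ->
    continuous2_on Q (fun t _ => g t)).
  { intros g Hg. apply continuous2_on_fst with (2 := Hg). intros t x [Ht _]. lra. }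
  assert (Cdiff : forall g1 g2, continuous_on (fun t => - tau <= t <= T) g1 ->
    continuous_on (fun t => - tau <= t <= T) g2 ->
    continuous2_on Q (fun t _ => (g2 t - g1 t) / L)).
  { intros g1 g2 Hg1 Hg2.
    apply continuous2_on_ext with (fun t _ => (g2 t + -1 * g1 t) * / L).
    - intros t x _. unfold Rdiv. ring.
    - apply continuous2_on_mult; [|apply continuous2_on_const].
      apply continuous2_on_plus; [now apply CQ|].
      apply continuous2_on_mult; [apply continuous2_on_const | now apply CQ]. }
  assert (Clift : forall g1 g2, continuous_on (fun t => - tau <= t <= T) g1 ->
    continuous_on (fun t => - tau <= t <= T) g2 -> continuous2_on Q (boundary_lift L g1 g2)).
  { intros g1 g2 Hg1 Hg2. apply continuous2_on_subset with (rect (- tau) T 0 L).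
    - intros t x [H1 H2]. split; [lra | exact H2].
    - now apply continuous2_on_lift. }
  (* the forcing is continuous across [t = tau], so that [dt (dt v)] is continuous on the whole
     rectangle; the statements on the strips are restrictions of this *)
  assert (Cvtt : continuous2_on Q (dt (dt v))).
  { apply (expands_continuous Q _ _ _ _ _ X20 D20); [|now apply Clift].
    intros n. now apply Cprod. }
  split; [now apply expands_converges with e00 G|].
  split; [|split; [exact (conj T01 (conj T02 (conj T10 T11)))|]].
  1: refine (conj _ (conj _ (conj _ (conj _ _)))).
  - apply (expands_continuous Q _ _ _ _ _ X00 D00); [|now apply Clift].
    intros n. now apply Cprod.
  - apply (expands_continuous Q _ _ _ _ _ X01 D01); [|now apply Cdiff].
    intros n. now apply Cprod.
  - apply (expands_continuous Q _ _ _ _ _ X02 D02); [|apply continuous2_on_const].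
    intros n. now apply Cprod.
  - apply (expands_continuous Q _ _ _ _ _ X10 D10); [|now apply Clift].
    intros n. now apply Cprod.
  - apply (expands_continuous Q _ _ _ _ _ X11 D11); [|now apply Cdiff].
    intros n. now apply Cprod.
  - intros m Hm. rewrite HK in Hm.
    assert (Hm1 : 1 <= INR m) by (change 1 with (INR 1); apply le_INR; lia).
    assert (HmN : INR m <= INR N) by (apply le_INR; lia).
    assert (Hstrip : forall t x, strip m t x -> Q t x).
    { intros t x [Ht Hx]. split; [|exact Hx]. rewrite hTN. split; nra. }
    assert (HmT : 0 < INR m * tau <= T) by (rewrite hTN; split; nra).
    split; [|split].
    + apply termwise_subset with Q; [exact Hstrip | exact T20].
    + apply continuous2_on_subset with Q; [exact Hstrip | exact Cvtt].
    + intros x Hx.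
      assert (Hlim : forall F0 : (R -> Prop) -> Prop, Filter F0 ->
        (forall eps : posreal, F0 (fun t => Rabs (t - INR m * tau) < eps /\ 0 <= t <= T)) ->
        exists l : R, filterlim (fun t => dt (dt v) t x) F0 (locally l)).
      { intros F0 HF0 H0. exists (dt (dt v) (INR m * tau) x).
        apply filterlim_R; [exact HF0|]. intros eps Heps.
        destruct (proj1 (continuous2_on_eps Q _) Cvtt (INR m * tau) x
          ltac:(split; [lra | exact Hx]) eps Heps) as [d Hd].
        generalize (H0 d). apply filter_imp. intros t [Ht1 Ht2].
        apply Hd; [exact Ht1| |now split].
        rewrite Rminus_diag, Rabs_R0. apply cond_pos. }
      split.
      * apply Hlim; [typeclasses eauto|]. intros eps.
        assert (He : 0 < Rmin eps (INR m * tau)) by (apply Rmin_glb_lt; [apply cond_pos | lra]).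
        exists (mkposreal _ He). refine (fun (t : R) Ht Htm => _).
        change (Rabs (t - INR m * tau) < Rmin eps (INR m * tau)) in Ht.
        pose proof (Rmin_l eps (INR m * tau)). pose proof (Rmin_r eps (INR m * tau)).
        split; [lra|]. apply Rabs_def2 in Ht. lra.
      * intros HmK. rewrite HK in HmK.
        assert (HmT' : INR m * tau < T).
        { rewrite hTN. apply Rmult_lt_compat_r; [lra|]. now apply lt_INR. }
        apply Hlim; [typeclasses eauto|]. intros eps.
        assert (He : 0 < Rmin eps (T - INR m * tau)) by (apply Rmin_glb_lt; [apply cond_pos | lra]).
        exists (mkposreal _ He). refine (fun (t : R) Ht Htm => _).
        change (Rabs (t - INR m * tau) < Rmin eps (T - INR m * tau)) in Ht.
        pose proof (Rmin_l eps (T - INR m * tau)). pose proof (Rmin_r eps (T - INR m * tau)).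
        split; [lra|]. apply Rabs_def2 in Ht. lra.
Qed.
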